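(* Let $p$ be an odd prime, and let $G$ be an Isaacs group of degree $p$. Then $G$ is $p$-closed, the normal Sylow $p$-subgroup of $G$ is extraspecial of order $p^3$, and a Hall $p$-complement of $G$ is cyclic of order $p-1$. Moreover, for each odd prime $p$, there is (up to isomorphism) exactly one Isaacs group of degree $p$ whose Sylow $p$-subgroup has exponent $p^2$, and there are (up to isomorphism) exactly $(p-1)/2$ Isaacs groups of degree $p$ whose Sylow $p$-subgroup has exponent $p$.
   Context: All groups are finite. For an integer $e > 1$, a group $G$ is an Isaacs group of degree $e$ if $|G| = e^4 - e^3$ and $d = e^2 - e$ is the degree of some irreducible complex character of $G$ (so that $|G| = d(d+e)$). A group is $p$-closed if it has a normal Sylow $p$-subgroup. A Hall $p$-complement of $G$ is a subgroup of order coprime to $p$ whose index is a power of $p$. *)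

(* Defs.v *)
From HB Require Import structures.
From mathcomp Require Import all_boot all_order all_algebra.
From mathcomp Require Import all_fingroup all_solvable all_field all_character.

Set Implicit Arguments.
Unset Strict Implicit.
Unset Printing Implicit Defensive.

Import GroupScope.

(* MathComp characters take their values in algC; every complex character of
   a finite group does, so these are the usual irreducible character degrees.
   Both subtractions are on nat, and exact since 1 < e. *)
Definition isaacs_group (e : nat) (gT : finGroupType) (G : {group gT}) : Prop :=
  [/\ (1 < e)%N,
      #|G| = (e ^ 4 - e ^ 3)%N
    & exists i : Iirr G, ('chi_i 1%g = (e ^ 2 - e)%N%:R)%R].

Definition p_closed (p : nat) (gT : finGroupType) (G : {group gT}) : Prop :=
  exists2 P : {group gT}, p.-Sylow(G) P & P <| G.

(* The Sylow p-subgroups exist and are conjugate, so "every" is "some". *)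
Definition sylow_exponent (p n : nat) (gT : finGroupType) (G : {group gT}) :
    Prop :=
  forall P : {group gT}, p.-Sylow(G) P -> exponent P = n.

(* Groups may live in different ambient finGroupTypes, so an irredundant list
   of representatives is a family of groups each with its own ambient type. *)
Definition num_iso_classes
    (C : forall gT : finGroupType, {group gT} -> Prop) (n : nat) : Prop :=
  exists (gT : 'I_n -> finGroupType) (G : forall i, {group gT i}),
    [/\ forall i, C (gT i) (G i),
        forall i j, G i \isog G j -> i = j
      & forall (rT : finGroupType) (H : {group rT}),
          C rT H -> exists i, H \isog G i].

(* Main.v *)
Require Import Defs.
From HB Require Import structures.
From mathcomp Require Import all_boot all_order all_algebra.
From mathcomp Require Import all_fingroup all_solvable all_field all_character.
From mathcomp Require Import zify ring.

(** A normal Sylow p-subgroup P exists because the number of Sylow subgroups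
    divides p - 1.  If psi in Irr(K) lies under the character chi of degree
    p(p - 1), then chi(1) <= |G : K| psi(1) and psi(1)^2 <= |K : Z(K)|.  With
    K = P this makes P nonabelian, hence extraspecial of order p^3; with
    K = C_G(Z(P)) it gives C_G(Z(P)) = P.  So a complement H acts regularly on
    the nontrivial elements of Z(P), and is generated by an element h acting on
    Z(P) as the r-th power, r being a primitive root mod p.

    All (p-1)-st roots of unity lie in F_p, so P is generated by elements x
    with x^h in <x>, and two of these, x and y, do not commute.  If
    x^h = x^a and y^h = y^b then ab = r mod p, as [x, y] generates Z(P).
    In exponent p this leaves {a, b} = {r^(k+1), r^-k} with
    0 <= k < (p-1)/2, and k is an invariant of G.  In exponent p^2 one may take
    x of order p^2, and a is then forced to be the Teichmueller lift r^p and
    b = 1.  These relations determine G up to isomorphism.  They are realised by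
    the Heisenberg group mod p extended by F_p^*, and by the affine group of
    Z/p^2. *)

Set Implicit Arguments.
Unset Strict Implicit.
Unset Printing Implicit Defensive.

Import Order.TTheory GroupScope GRing.Theory Num.Theory FinRing.Theory.

(** * Structure of Isaacs groups of prime degree *)

(** By Frobenius reciprocity, ['chi_i] is a constituent of the character induced from any
    constituent of its restriction to [K]. *)
Lemma irr1_le_index (gT : finGroupType) (G K : {group gT}) (i : Iirr G) :
  K \subset G ->
  exists j : Iirr K, ('chi_i 1%g <= #|G : K|%:R * 'chi_j 1%g)%R.
Proof.
move=> sKG; have [j jRi] := constt_cfRes_irr K i.
exists j; rewrite -cfInd1 //; apply: char1_ge_constt.
  by rewrite cfInd_char ?irr_char.
by rewrite constt_Ind_Res.
Qed.

(** The bound chi(1)^2 <= |G : Z(chi)| applies, and the centre of [G] lies in every Z(chi). *)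
Lemma irr1_sqr_le (gT : finGroupType) (G Z : {group gT}) (i : Iirr G) :
  Z \subset 'Z(G) -> ('chi_i 1%g ^+ 2 <= #|G : Z|%:R)%R.
Proof.
move=> sZ; apply: (le_trans (irr1_bound i)).
rewrite ler_nat dvdn_leq // indexgS //.
by apply: (subset_trans sZ); rewrite -cap_cfcenter_irr bigcap_inf.
Qed.

Lemma isaacs_sylow_normal (p : nat) (gT : finGroupType) (G P : {group gT}) :
  prime p -> #|G| = (p ^ 4 - p ^ 3)%N -> p.-Sylow(G) P ->
  P <| G /\ #|P| = (p ^ 3)%N.
Proof.
move=> p_pr oG sylP; have p1 := prime_gt1 p_pr.
have oGE : #|G| = (p ^ 3 * (p - 1))%N by rewrite oG mulnBr muln1 -expnSr.
have cop : coprime p (p - 1).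
  by rewrite prime_coprime // gtnNdvd //; lia.
have oP : #|P| = (p ^ 3)%N.
  rewrite (card_Hall sylP) oGE partnM ?expn_gt0 ?subn_gt0 ?prime_gt0 //.
  rewrite part_pnat_id ?pnatX ?pnat_id // part_p'nat ?muln1 //.
  by rewrite p'natE // -prime_coprime.
split=> //; have sPG := pHall_sub sylP.
have := card_Syl_mod G p_pr; rewrite (card_Syl sylP).
have dvd : #|G : 'N_G(P)| %| (p - 1).
  apply: (@dvdn_trans #|G : P|); first by rewrite indexgS // subsetI sPG normG.
  by rewrite -divgS // oP oGE mulKn // expn_gt0 prime_gt0.
(* The number of Sylow subgroups divides p - 1, so it is smaller than p and equals its residue 1. *)
rewrite modn_small => [/eqP|]; last first.
  apply: leq_ltn_trans (dvdn_leq _ dvd) _; rewrite ?subn_gt0 //.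
  by rewrite subn1 ltn_predL prime_gt0.
by rewrite indexg_eq1 subsetI subxx /= => nPG; rewrite /normal sPG.
Qed.

Lemma isaacs_structure (p : nat) (gT : finGroupType) (G P : {group gT}) :
  prime p -> isaacs_group p G -> p.-Sylow(G) P ->
  [/\ P <| G, extraspecial P, #|P| = (p ^ 3)%N & 'C_G('Z(P)) = P].
Proof.
move=> p_pr [p1 oG [i chi1]] sylP.
have [nPG oP] := isaacs_sylow_normal p_pr oG sylP.
have sPG := normal_sub nPG; have pP := pHall_pgroup sylP.
have oGE : #|G| = (p ^ 3 * (p - 1))%N by rewrite oG mulnBr muln1 -expnSr.
have iGP : #|G : P| = (p - 1)%N.
  by rewrite -divgS // oP oGE mulKn // expn_gt0 prime_gt0.
(* If [P] were abelian, psi(1) = 1 would give p(p - 1) <= p - 1. *)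
have nabP : ~~ abelian P.
  apply/negP => abP; have [j] := irr1_le_index i sPG.
  have /andP[_ /eqP ->] := char_abelianP _ abP j.
  rewrite chi1 mulr1 iGP ler_nat leqNgt (_ : (p ^ 2 - p = p * (p - 1))%N).
    by rewrite -{1}[(p - 1)%N]mul1n ltn_pmul2r ?p1 // subn_gt0.
  by rewrite mulnBr muln1.
have esP : extraspecial P.
  by apply: p3group_extraspecial pP nabP _; rewrite oP pfactorK.
split=> //; apply/eqP; rewrite eq_sym eqEsubset.
(* K = P by p(p-1) <= |G : K| psi(1) and psi(1)^2 <= |K : Z(P)|. *)
set K := 'C_G('Z(P)).
have sPK : P \subset K by rewrite subsetI sPG centsC subsetIr.
rewrite sPK /=.
have sKG : K \subset G by apply: subsetIl.
have [j] := irr1_le_index i sKG.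
have sZ : 'Z(P) \subset 'Z(K).
  rewrite subsetI (subset_trans (center_sub P)) //=.
  by rewrite centsC subsetIr.
have := irr1_sqr_le j sZ.
have /natrP [n ->] := Cnat_irr1 j.
rewrite -natrX chi1 -natrM !ler_nat.
have := Lagrange_index sKG sPK; rewrite iGP.
have oZ := card_center_extraspecial pP esP.
have iPZ : #|P : 'Z(P)| = (p ^ 2)%N.
  by rewrite -divgS ?center_sub // oP oZ expnS mulKn // prime_gt0.
rewrite -(Lagrange_index sPK (center_sub P)) iPZ -indexg_eq1.
have : #|K : P| > 0 by [].
(* With n = psi(1), one has a b = p - 1, p a b <= a n and n^2 <= p^2 b. So p b <= n, and squaring
   forces b = 1. *)
move: #|G : K| #|K : P| => a b b0 ab le1 le2.
have a0 : a > 0 by rewrite -(ltn_pmul2r b0) mul0n; lia.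
have le_n : p * b <= n by rewrite -(leq_pmul2l a0) mulnCA; lia.
have : (p * b) ^ 2 <= p ^ 2 * b.
  by apply: leq_trans (_ : n ^ 2 <= _); rewrite ?leq_sqr // mulnC.
rewrite expnMn leq_pmul2l ?expn_gt0 ?prime_gt0 // -[leqRHS]muln1.
by rewrite leq_pmul2l // eqn_leq b0 => ->.
Qed.

(** * Primitive roots and eigenvectors *)

(** The first clause lets exponents of r be compared mod p - 1; the second supplies discrete
    logarithms of eigenvalues. *)
Definition primitive_root_mod (p r : nat) : Prop :=
  (forall n, (r ^ n == 1 %[mod p]) = (p.-1 %| n))
  /\ (forall a, ~~ (p %| a) -> exists i, a = r ^ i %[mod p]).

Lemma eqn_mod_Fp (p a b : nat) :
  prime p -> (a == b %[mod p]) = (a%:R == b%:R :> 'F_p)%R.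
Proof.
move=> p_pr; rewrite -val_eqE /=.
by have := val_Fp_nat p_pr a; have := val_Fp_nat p_pr b; rewrite /= => -> ->.
Qed.

(** The unit group of the field ['F_p] is cyclic of order p - 1; r is a generator read as a natural
    number. *)
Lemma ex_primitive_root_mod (p : nat) :
  prime p -> exists r, primitive_root_mod p r.
Proof.
move=> p_pr; have /cyclicP[u gen_u] := field_unit_group_cyclic [set: {unit 'F_p}]%G.
have ou : #[u] = p.-1.
  by rewrite orderE -gen_u card_finField_unit card_Fp.
exists (val (val u)); split=> [n | a pa].
  rewrite eqn_mod_Fp // natrX natr_Zp -ou order_dvdn -val_unitX.
  by apply/eqP/eqP=> [un1 | -> //]; apply: val_inj.
have Ua : (a%:R : 'F_p)%R \is a GRing.unit by rewrite unitFpE ?prime_coprime.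
have : (FinRing.Unit Ua : {unit 'F_p}) \in <[u]> by rewrite -gen_u inE.
case/cycleP=> i Da; exists i; apply/eqP; rewrite eqn_mod_Fp // natrX natr_Zp.
by rewrite -val_unitX -Da.
Qed.

Lemma primitive_root_coprime (p r : nat) :
  prime p -> primitive_root_mod p r -> coprime p r.
Proof.
move=> p_pr [r1 _]; rewrite prime_coprime //; apply/negP => pr.
have := r1 p.-1; rewrite dvdnn eqn_mod_Fp // natrX.
have /eqP -> : (r%:R == 0%:R :> 'F_p)%R by rewrite -eqn_mod_Fp // mod0n.
have -> : p.-1 = p.-2.+1 by have := prime_gt1 p_pr; lia.
by rewrite expr0n /= eq_sym oner_eq0.
Qed.

Lemma primitive_root_eq_mod (p r i j : nat) :
  prime p -> primitive_root_mod p r ->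
  (r ^ i == r ^ j %[mod p]) = (i == j %[mod p.-1]).
Proof.
move=> p_pr Pr; have co := primitive_root_coprime p_pr Pr.
wlog le_ji : i j / j <= i => [hw|].
  by case/orP: (leq_total i j) => /hw //; rewrite eq_sym => ->; rewrite eq_sym.
have Ur : (r%:R : 'F_p)%R != 0%R by rewrite -unitfE unitFpE.
rewrite [RHS]eqn_mod_dvd // -(proj1 Pr) !eqn_mod_Fp // !natrX -{1}(subnK le_ji).
by rewrite exprD -[X in (_ == X)%R]mul1r (inj_eq (mulIf _)) // expf_neq0.
Qed.

(** Over ['F_p] the sum of x^m is -1 if p - 1 divides m, since x^m = 1 for x nonzero. Otherwise x ->
    r x permutes the field and multiplies the sum by r^m <> 1, so the sum is 0. *)
Lemma prime_dvd_power_sum (p m : nat) :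
  prime p -> 0 < m -> p %| (p.-1 %| m) + \sum_(c < p) c ^ m.
Proof.
move=> p_pr m0; have [r [r1 r2]] := ex_primitive_root_mod p_pr.
have p1 := prime_gt1 p_pr.
suff: (\sum_(x : 'F_p) x ^+ m = - (p.-1 %| m)%:R)%R.
  move=> sumE; have := eqn_mod_Fp ((p.-1 %| m) + \sum_(c < p) c ^ m) 0 p_pr.
  rewrite mod0n /dvdn => ->; rewrite natrD natr_sum.
  rewrite -(big_mkord xpredT (fun c => (c ^ m)%:R : 'F_p)%R).
  rewrite -[X in index_iota 0 X](Fp_cast p_pr) big_mkord.
  under eq_bigr do rewrite natrX natr_Zp.
  by rewrite sumE subrr.
have co := primitive_root_coprime p_pr (conj r1 r2).
have Ur : (r%:R : 'F_p)%R != 0%R by rewrite -unitfE unitFpE.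
case: (boolP (p.-1 %| m)) => [dvd_m | ndvd_m].
  rewrite (bigD1 0%R) //= expr0n eqn0Ngt m0 add0r.
  rewrite (eq_bigr (fun _ => 1%R)) => [|x x0]; last first.
    case/dvdnP: dvd_m => q ->; rewrite mulnC exprM.
    rewrite (_ : x ^+ p.-1 = 1)%R ?expr1n //.
    apply: (mulfI x0); rewrite -exprS prednK ?prime_gt0 // mulr1.
    by have := expf_card x; rewrite card_Fp.
  rewrite sumr_const cardC1 card_Fp // -subn1 natrB ?prime_gt0 //.
  by rewrite pchar_Fp_0 // sub0r.
have r_m1 : ((r%:R : 'F_p) ^+ m != 1)%R.
  by rewrite -natrX -[1%R]/(1%:R)%R -eqn_mod_Fp // r1.
apply/eqP; rewrite oppr0; move: r_m1; apply: contraNT => S0.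
apply/eqP; apply: (mulIf S0); rewrite mul1r mulr_sumr.
rewrite [RHS](reindex_inj (mulfI Ur)) /=.
by apply: eq_bigr => x _; rewrite exprMn.
Qed.

(* Lagrange interpolation at the roots of X^(p-1) - 1: the c-component of v is
   the product of the (v ^ h ^ i) ^ (c ^ (p - 1 - i)). *)
Lemma abelian_gen_eigen (p : nat) (gT : finGroupType) (A : {group gT}) (h : gT) :
    prime p -> abelian A -> exponent A %| p -> h \in 'N(A) ->
    h ^+ p.-1 \in 'C(A) ->
  A \subset <<[set x in A | x ^ h \in <[x]>]>>.
Proof.
move=> p_pr abA expA nAh cAh; set S := [set x in A | _].
(* The components found below multiply to the inverse of v, because the power sum of exponent p - 1
   is -1 mod p. *)
apply/subsetP => v Av; rewrite -groupV.
pose u := FiniteModule.fmod abA v.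
have valu : val u = v by rewrite FiniteModule.fmodK.
have eqMn a b (x : FiniteModule.fmod_of abA) :
  a = b %[mod p] -> (x *+ a = x *+ b)%R.
- have xp n : (x *+ n = x *+ (n %% p))%R.
    rewrite {1}(divn_eq n p) mulrnDr mulnC mulrnA.
    rewrite (_ : x *+ p = 0)%R ?mul0rn ?add0r //.
    apply: val_inj; rewrite FiniteModule.fmvalZ FiniteModule.fmval0.
    exact: exponentP (FiniteModule.fmodP x).
  by move=> eq_ab; rewrite xp eq_ab -xp.
pose M i := FiniteModule.actr u (h ^+ i).
pose w c := (\sum_(i < p.-1) M i *+ c ^ (p.-1 - i))%R.
have p1 := prime_gt1 p_pr; have pK : p.-1.+1 = p by rewrite prednK ?prime_gt0.
have wh c : FiniteModule.actr (w c) h = (w c *+ c)%R.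
  (* Both sides are sums of [F] over shifted ranges. They agree because F 0 = F (p - 1), by c^p = c
     mod p and the triviality of h^(p - 1) on [A]. *)
  pose F j := (M j *+ c ^ (p - j))%R.
  have -> : FiniteModule.actr (w c) h = (\sum_(i < p.-1) F i.+1)%R.
    rewrite FiniteModule.actr_sum; apply: eq_bigr => i _.
    rewrite FiniteModule.actZr -FiniteModule.actrM ?groupX // -expgSr /F.
    by congr (_ *+ c ^ _)%R; lia.
  have -> : (w c *+ c = \sum_(i < p.-1) F i)%R.
    rewrite -sumrMnl; apply: eq_bigr => i _.
    rewrite -mulrnA -expnSr /F; congr (_ *+ c ^ _)%R.
    by have := ltn_ord i; lia.
  apply: (@addrI _ (F 0)).
  rewrite -(big_ord_recl p.-1 (fun i => F i)) big_ord_recr addrC /=.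
  congr (_ + _)%R; rewrite /F subn0 (_ : p - p.-1 = 1%N); last lia.
  rewrite /M expg0 FiniteModule.actr1 (_ : FiniteModule.actr u _ = u).
    by apply: eqMn; rewrite expn1 fermat_little.
  apply: val_inj; rewrite FiniteModule.fmvalJ ?groupX // valu.
  by rewrite conjgE -(centP cAh) ?mulKg.
(* The coefficient of [M i] is the sum of the c^(p - 1 - i), which mod p is -1 for i = 0 and 0 for
   the other i. *)
have sum_w : (\sum_(c < p) w c = - u)%R.
  rewrite /w exchange_big /=.
  have -> : (\sum_(i < p.-1) \sum_(c < p) M i *+ c ^ (p.-1 - i) =
             \sum_(i < p.-1) if i == 0 :> nat then - u else 0)%R.
    apply: eq_bigr => i _; rewrite sumrMnr.
    have pos : 0 < p.-1 - i by rewrite subn_gt0.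
    have := prime_dvd_power_sum p_pr pos.
    move: (\sum_(c < p) c ^ (p.-1 - i)) => n.
    case: eqP => [i0 | /eqP i0].
      rewrite i0 subn0 dvdnn => p_n; apply/eqP; rewrite -addr_eq0 addrC.
      rewrite /M expg0 FiniteModule.actr1 -mulrS -[0%R](mulr0n u).
      by apply/eqP/eqMn/eqP; rewrite mod0n.
    have i_gt0 : 0 < i by rewrite lt0n.
    have -> : (p.-1 %| p.-1 - i) = false by rewrite gtnNdvd //; lia.
    by move=> p_n; rewrite -[0%R](mulr0n (M i)); apply/eqMn/eqP; rewrite mod0n.
  have q0 : 0 < p.-1 by lia.
  rewrite (bigD1 (Ordinal q0)) //= big1 ?addr0 // => i i0.
  by case: eqP => // ei; case/eqP: i0; apply: val_inj.
rewrite (_ : v^-1 = FiniteModule.fmval (\sum_(c < p) w c)%R);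
  last by rewrite sum_w; have := FiniteModule.fmvalN u; rewrite valu.
elim/big_ind: _ => [|x y Sx Sy|c _]; first exact: group1.
  by rewrite (FiniteModule.fmvalA x y) groupM.
apply/mem_gen; rewrite inE FiniteModule.fmodP -FiniteModule.fmvalJ // wh.
by rewrite (FiniteModule.fmvalZ c (w c)) mem_cycle.
Qed.

(** * The complement and its eigenvectors in P *)

Lemma conjg_expn_iter (gT : finGroupType) (A : {group gT}) (h : gT) (r n : nat) :
    {in A, forall z, z ^ h = z ^+ r} ->
  {in A, forall z, z ^ (h ^+ n) = z ^+ (r ^ n)}.
Proof.
move=> Ah z Az; elim: n => [|n IHn]; first by rewrite conjg1 expg1.
by rewrite expgSr conjgM IHn conjXg Ah // -expgM -expnS.
Qed.

(** [H] meets [P] = C_G(Z(P)) trivially, so it permutes the p - 1 nontrivial elements of Z(P)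
    regularly. The h taking z to z^r has order divisible by p - 1, hence generates [H]. *)
Lemma isaacs_complement (p r : nat) (gT : finGroupType) (G P H : {group gT}) :
    prime p -> primitive_root_mod p r -> isaacs_group p G ->
    p.-Sylow(G) P -> p^'.-Hall(G) H ->
  exists h, [/\ H :=: <[h]>, #[h] = p.-1
              & {in 'Z(P), forall z, z ^ h = z ^+ r}].
Proof.
move=> p_pr Pr isG sylP hallH; have p_gt0 := prime_gt0 p_pr.
have [nPG esP oP cGZ] := isaacs_structure p_pr isG sylP.
have sHG := pHall_sub hallH; have pP := pHall_pgroup sylP.
have oH : #|H| = p.-1.
  have := partnC p (cardG_gt0 G); rewrite -(card_Hall hallH) -(card_Hall sylP).
  case: isG => _ -> _; rewrite oP => oG.
  apply/eqP; rewrite -(eqn_pmul2l (_ : 0 < p ^ 3)) ?expn_gt0 ?p_gt0 // oG.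
  by rewrite -subn1 mulnBr muln1 -expnSr.
have oZ := card_center_extraspecial pP esP.
have nZH : H \subset 'N('Z(P)).
  by rewrite (subset_trans sHG) // normal_norm // gFnormal_trans.
have tiHP : H :&: P = 1.
  by rewrite setIC; apply: coprime_TIg; rewrite (pnat_coprime pP (pHall_pgroup hallH)).
have ntZ : 'Z(P) != 1 by rewrite -cardG_gt1 oZ prime_gt1.
have [z Zz ntz] := trivgPn _ ntZ.
have oz : #[z] = p by apply: nt_prime_order => //; rewrite -oZ expg_cardG.
have genZ : 'Z(P) = <[z]>.
  by apply/eqP; rewrite eq_sym eqEcard cycle_subG Zz -orderE oz oZ /=.
pose f h := z ^ h.
have f_inj : {in H &, injective f}.
  move=> a b Ha Hb /= eq_ab; apply/eqP; rewrite eq_mulgV1 -in_set1 -[[set 1]]tiHP.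
  rewrite inE groupM ?groupV //= -cGZ inE groupM ?groupV ?(subsetP sHG) //=.
  rewrite genZ cent_cycle; apply/cent1P/commute_sym/commgP/conjg_fixP.
  by rewrite conjgM [z ^ a]eq_ab -conjgM mulgV conjg1.
have f_im : f @: H = 'Z(P)^#.
  apply/eqP; rewrite eqEcard card_in_imset // oH -(prednK p_gt0) -oZ.
  rewrite (cardsD1 1 'Z(P)) group1 leqnn andbT.
  apply/subsetP=> _ /imsetP[a Ha ->]; rewrite /f in_setD1 conjg_eq1 ntz.
  by rewrite memJ_norm // (subsetP nZH).
have : z ^+ r \in f @: H.
  rewrite f_im in_setD1 groupX // andbT -order_dvdn oz -prime_coprime //.
  exact: primitive_root_coprime Pr.
case/imsetP=> h Hh zh; have Zh : {in 'Z(P), forall x, x ^ h = x ^+ r}.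
  move=> x; rewrite genZ => /cycleP[k ->].
  by rewrite conjXg -/(f h) -zh -!expgM mulnC.
have oh : #[h] = p.-1.
  apply/eqP; rewrite eqn_dvd -{1}oH order_dvdG //= -(proj1 Pr).
  have := conjg_expn_iter #[h] Zh Zz; rewrite expg_order conjg1 => /esym/eqP.
  by rewrite -{2}[z]expg1 eq_expg_mod_order oz.
exists h; split=> //; apply/eqP.
by rewrite eq_sym eqEcard cycle_subG Hh -orderE oh oH /=.
Qed.

Lemma norm_gen (gT : finGroupType) (A : {set gT}) (h : gT) :
  {in A, forall x, x ^ h \in <<A>>} -> h \in 'N(<<A>>).
Proof.
move=> Ah; rewrite inE -genJ gen_subG; apply/subsetP=> _ /imsetP[x Ax ->].
exact: Ah.
Qed.

(** The statement for abelian groups is applied to P / Z(P), and each eigenvector of the quotient is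
    lifted to a product of eigenvectors in [P]. *)
Lemma extraspecial_gen_eigen (p : nat) (gT : finGroupType) (P : {group gT}) (h : gT) :
    p.-group P -> extraspecial P -> h \in 'N(P) -> h ^+ p.-1 = 1 ->
  P \subset <<[set x in P | x ^ h \in <[x]>]>>.
Proof.
move=> pP esP nPh h1; have p_pr := extraspecial_prime pP esP.
set S := [set x in P | _].
have [[PhiP _] _] := esP; have oZ := card_center_extraspecial pP esP.
have nZh : h \in 'N('Z(P)) by apply: subsetP nPh; apply: gFnorms.
have nZP : P \subset 'N('Z(P)) by apply: gFnorm.
have abPZ : p.-abelem (P / 'Z(P)) by rewrite -PhiP Phi_quotient_abelem.
have [cPZ expPZ] := abelemP p_pr abPZ.
have expZ x : x \in P -> x ^+ p \in 'Z(P).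
  move=> Px; have nZx := subsetP nZP x Px.
  by apply: coset_idr; rewrite ?groupX // morphX // expPZ ?mem_quotient.
have Zp z : z \in 'Z(P) -> z ^+ p = 1.
  by move=> Zz; rewrite -oZ expg_cardG.
have lift x : x \in P ->
  coset 'Z(P) x ^ coset 'Z(P) h \in <[coset 'Z(P) x]> -> x \in <<S>>.
- move=> Px xh; have nZx := subsetP nZP x Px.
  have {xh} [k [z Zz xh]] : exists k, exists2 z, z \in 'Z(P) & x ^ h = x ^+ k * z.
    case/cycleP: xh => k; rewrite -morphJ // -morphX // => /rcoset_kercosetP.
    rewrite !(groupX, groupJ) // => /(_ isT isT) /rcosetP[z Zz ->].
    exists k, z => //; apply: (centsP (subsetIr P 'C(P))) => //; exact: groupX.
  have cxZ : <[x]> \subset 'C('Z(P)).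
    have : P \subset 'C('Z(P)) by rewrite centsC subsetIr.
    by rewrite cycle_subG => /subsetP ->.
  have [xp | nxp] := eqVneq (x ^+ p) 1.
    (* If x^p = 1, then <x> Z(P) is abelian of exponent dividing p and normalised by h, so its
       eigenvectors generate it. *)
    pose E := (<[x]> <*> 'Z(P))%G.
    have EE : E :=: <[x]> * 'Z(P) by rewrite /= cent_joinEl.
    have sEP : E \subset P by rewrite join_subG cycle_subG Px center_sub.
    have abE : abelian E.
      by rewrite abelianY cycle_abelian center_abelian centsC.
    have expE : exponent E %| p.
      apply/exponentP=> y; rewrite EE => /mulsgP[_ t /cycleP[i ->] Zt ->].
      rewrite expgMn; last by apply: (centsP cxZ _ _ _ Zt); rewrite mem_cycle.
      by rewrite -expgM mulnC expgM xp expg1n Zp ?mulg1.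
    have nEh : h \in 'N(E).
      apply: norm_gen => y /setUP[/cycleP[i ->] | Zy].
        rewrite conjXg xh groupX // -/(E : {set gT}) groupM ?groupX //.
        - by rewrite mem_gen // inE cycle_id.
        - by rewrite mem_gen // inE Zz orbT.
      by rewrite mem_gen // in_setU (memJ_norm _ nZh) Zy orbT.
    have := abelian_gen_eigen p_pr abE expE nEh.
    rewrite h1 group1 => /(_ isT)/subsetP/(_ x) xE.
    apply: subsetP (xE _); last by rewrite mem_gen // inE cycle_id.
    apply: genS; apply/subsetP=> y; rewrite !inE => /andP[Ey ->].
    by rewrite (subsetP sEP).
  (* If x^p is nontrivial it generates Z(P), so z is a power of x and x is itself an eigenvector. *)
  apply: mem_gen; rewrite inE Px xh groupMl ?mem_cycle //.
  suff /eqP ZE : <[x ^+ p]> == 'Z(P).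
    by apply: subsetP Zz; rewrite -ZE cycle_subG mem_cycle.
  rewrite eqEcard cycle_subG expZ //= -orderE oZ.
  by rewrite (@nt_prime_order _ p _ p_pr (Zp _ (expZ x Px)) nxp).
have nPZh : coset 'Z(P) h \in 'N(P / 'Z(P)).
  by apply: (subsetP (quotient_norm _ _)); apply: mem_quotient.
have /and3P[_ _ expAPZ] := abPZ.
have := abelian_gen_eigen p_pr cPZ expAPZ nPZh.
rewrite -morphX // h1 morph1 group1 => /(_ isT) sPZ.
(* Comparison in the quotient requires Z(P) inside the generated subgroup; this is [lift] for a
   trivial coset. *)
rewrite -(quotientSGK nZP); last first.
  apply/subsetP=> z Zz; apply: lift; first by rewrite (subsetP (center_sub P)).
  by rewrite coset_id // conj1g group1.
apply: subset_trans sPZ _; rewrite gen_subG; apply/subsetP=> y.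
rewrite inE => /andP[/morphimP[x nZx Px -> xh]].
by rewrite mem_quotient // lift.
Qed.

(** * Generators and relations *)

(* Both groups are projections of the subgroup of their product generated by
   the pairs of generators, which also satisfies the relations. *)
Lemma isog_of_relators (R : forall gT : finGroupType, gT -> gT -> gT -> Prop)
    (n : nat) (gT rT : finGroupType) (G : {group gT}) (H : {group rT})
    (x y h : gT) (x' y' h' : rT) :
    R _ x y h -> R _ x' y' h' ->
    R _ (x, x') (y, y') (h, h') ->
    (forall (aT : finGroupType) (a b c : aT),
       R _ a b c -> #|<<[set a; b; c]>>| <= n) ->
    G :=: <<[set x; y; h]>> -> H :=: <<[set x'; y'; h']>> ->
    #|G| = n -> #|H| = n ->
  G \isog H.
Proof.
move=> Rx Rx' Rxx' leR GE HE oG oH.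
pose D := <<[set (x, x'); (y, y'); (h, h')]>>%G.
have oD : #|D| <= n by apply: leR.
have D1 : fst @* D = G.
  by rewrite morphim_gen ?subsetT // !morphimU !morphim_set1 ?inE -?GE.
have D2 : snd @* D = H.
  by rewrite morphim_gen ?subsetT // !morphimU !morphim_set1 ?inE -?HE.
have isoGD : G \isog D.
  by rewrite isogEcard oG oD andbT -D1 morphim_homg ?subsetT.
have isoHD : H \isog D.
  by rewrite isogEcard oH oD andbT -D2 morphim_homg ?subsetT.
by rewrite (isog_transl _ isoGD) isog_sym.
Qed.


Lemma card_joing_norm (gT : finGroupType) (A B : {group gT}) (m n : nat) :
  B \subset 'N(A) -> #|A| <= m -> #|B| <= n -> #|A <*> B| <= m * n.
Proof.
move=> nAB lem len; rewrite norm_joinEr //.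
apply: leq_trans (leq_mul lem len).
by rewrite mul_cardG leq_pmulr ?cardG_gt0.
Qed.

(** Relations of the Heisenberg group mod p extended by a diagonal h. They imply that h acts on
    [[~ x, y]] as the power [a * b]. *)
Definition exponent_p_relations (p a b : nat) (gT : finGroupType) (x y h : gT) :=
  [/\ [/\ x ^+ p = 1, y ^+ p = 1 & h ^+ p.-1 = 1],
      commute x [~ x, y], commute y [~ x, y], x ^ h = x ^+ a & y ^ h = y ^+ b].

Definition exponent_p2_relations (p a : nat) (gT : finGroupType) (x y h : gT) :=
  [/\ [/\ x ^+ (p ^ 2) = 1, y ^+ p = 1 & h ^+ p.-1 = 1],
      [~ x, y] = x ^+ p, x ^ h = x ^+ a & y ^ h = y].

Lemma card_cycle_le (gT : finGroupType) (x : gT) (n : nat) :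
  0 < n -> x ^+ n = 1 -> #|<[x]>| <= n.
Proof. by move=> n0 /eqP xn; rewrite -orderE dvdn_leq // order_dvdn. Qed.

(** Adjoining [[~ x, y]], x, y, h in this order, each generator normalises what precedes and has
    order at most p, p, p and p - 1. *)
Lemma card_exponent_p_relations (p a b : nat) (gT : finGroupType) (x y h : gT) :
    1 < p -> exponent_p_relations p a b x y h ->
  #|<<[set x; y; h]>>| <= p ^ 3 * p.-1.
Proof.
move=> p1 [[xp yp hp] cxz cyz xh yh].
have p0 : 0 < p by lia.
set z := [~ x, y] in cxz cyz.
have zp : z ^+ p = 1 by rewrite -commXg // xp comm1g.
pose K := (<[z]> <*> <[x]>)%G; pose L := (K <*> <[y]>)%G.
have Kx : x \in K by rewrite mem_gen // inE cycle_id orbT.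
have Kz : z \in K by rewrite mem_gen // inE cycle_id.
have Ly : y \in L by rewrite mem_gen // inE cycle_id orbT.
have sKL : K \subset L by apply: joing_subl.
have oK : #|K| <= p * p.
  apply: card_joing_norm; rewrite ?card_cycle_le //.
  by rewrite cents_norm // cycle_subG /= cent_cycle; apply/cent1P.
have oL : #|L| <= p * p * p.
  apply: card_joing_norm; rewrite ?card_cycle_le //.
  rewrite cycle_subG; apply: norm_gen => t.
  case/setUP=> /cycleP[i ->]; rewrite conjXg groupX //.
    by rewrite (_ : z ^ y = z) //; apply/conjg_fixP/commgP/commute_sym.
  by rewrite conjg_mulR groupM.
have nLh : h \in 'N(L).
  have Lxh : x ^ h \in L by rewrite xh groupX // (subsetP sKL).
  have Lyh : y ^ h \in L by rewrite yh groupX.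
  have Lzh : z ^ h \in L by rewrite conjRg groupR.
  apply: norm_gen => t /setUP[Kt | /cycleP[i ->]]; last by rewrite conjXg groupX.
  rewrite -/(L : {set gT}).
  have : t ^ h \in K :^ h by rewrite memJ_conjg.
  apply: subsetP; rewrite /= -genJ gen_subG; apply/subsetP=> _ /imsetP[s + ->].
  by case/setUP=> /cycleP[i ->]; rewrite conjXg groupX.
have -> : (p ^ 3 = p * p * p)%N by rewrite !expnS expn0 muln1 mulnA.
apply: leq_trans (card_joing_norm _ oL (card_cycle_le _ hp)); last 2 first.
- by rewrite cycle_subG.
- by lia.
apply: subset_leq_card; rewrite gen_subG.
apply/subsetP=> t /setUP[/set2P[]|/set1P] ->.
- by rewrite (subsetP (joing_subl _ _)) // (subsetP sKL).
- by rewrite (subsetP (joing_subl _ _)).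
by rewrite (subsetP (joing_subr _ _)) ?cycle_id.
Qed.

Lemma card_exponent_p2_relations (p a : nat) (gT : finGroupType) (x y h : gT) :
    1 < p -> exponent_p2_relations p a x y h ->
  #|<<[set x; y; h]>>| <= p ^ 3 * p.-1.
Proof.
move=> p1 [[xp yp hp] xy xh yh]; have p0 : 0 < p by lia.
pose L := (<[x]> <*> <[y]>)%G.
have Lx : x \in L by rewrite mem_gen // inE cycle_id.
have Ly : y \in L by rewrite mem_gen // inE cycle_id orbT.
have oL : #|L| <= p ^ 2 * p.
  apply: card_joing_norm; rewrite ?card_cycle_le ?expn_gt0 ?p0 //.
  rewrite cycle_subG; apply: norm_gen => t /set1P ->.
  by rewrite conjg_mulR xy -expgS mem_cycle.
have nLh : h \in 'N(L).
  apply: norm_gen => t /setUP[] /cycleP[i ->]; rewrite conjXg ?xh ?yh groupX //.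
  by rewrite groupX.
rewrite expnSr.
apply: leq_trans (card_joing_norm _ oL (card_cycle_le _ hp)); last 2 first.
- by rewrite cycle_subG.
- by lia.
apply: subset_leq_card; rewrite gen_subG.
apply/subsetP=> t /setUP[/set2P[]|/set1P] ->.
- by rewrite (subsetP (joing_subl _ _)).
- by rewrite (subsetP (joing_subl _ _)).
by rewrite (subsetP (joing_subr _ _)) ?cycle_id.
Qed.

Lemma expg_pair (gT rT : finGroupType) (x : gT) (y : rT) (n : nat) :
  (x, y) ^+ n = (x ^+ n, y ^+ n).
Proof. by elim: n => // n IHn; rewrite !expgS IHn. Qed.

(** Relations that hold in both components hold for pairs, so the order bound determines the
    isomorphism type. *)
Lemma isog_exponent_p_relations (p a b : nat) (gT rT : finGroupType)
    (G : {group gT}) (H : {group rT}) (x y h : gT) (x' y' h' : rT) :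
    1 < p ->
    exponent_p_relations p a b x y h -> exponent_p_relations p a b x' y' h' ->
    G :=: <<[set x; y; h]>> -> H :=: <<[set x'; y'; h']>> ->
    #|G| = (p ^ 3 * p.-1)%N -> #|H| = (p ^ 3 * p.-1)%N ->
  G \isog H.
Proof.
move=> p1 Rx Rx'; apply: (isog_of_relators Rx Rx') => [|aT u v w].
  case: Rx => [[xp yp hp] cx cy xh yh]; case: Rx' => [[xp' yp' hp'] cx' cy' xh' yh'].
  rewrite /exponent_p_relations !expg_pair xp yp hp xp' yp' hp'.
  have -> : [~ (x, x'), (y, y')] = ([~ x, y], [~ x', y']) by [].
  have -> : (x, x') ^ (h, h') = (x ^ h, x' ^ h') by [].
  have -> : (y, y') ^ (h, h') = (y ^ h, y' ^ h') by [].
  by split; rewrite ?xh ?yh ?xh' ?yh' //; congr (_, _).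
exact: card_exponent_p_relations.
Qed.

Lemma isog_exponent_p2_relations (p a : nat) (gT rT : finGroupType)
    (G : {group gT}) (H : {group rT}) (x y h : gT) (x' y' h' : rT) :
    1 < p ->
    exponent_p2_relations p a x y h -> exponent_p2_relations p a x' y' h' ->
    G :=: <<[set x; y; h]>> -> H :=: <<[set x'; y'; h']>> ->
    #|G| = (p ^ 3 * p.-1)%N -> #|H| = (p ^ 3 * p.-1)%N ->
  G \isog H.
Proof.
move=> p1 Rx Rx'; apply: (isog_of_relators Rx Rx') => [|aT u v w].
  case: Rx => [[xp yp hp] xy xh yh]; case: Rx' => [[xp' yp' hp'] xy' xh' yh'].
  rewrite /exponent_p2_relations !expg_pair xp yp hp xp' yp' hp'.
  have -> : [~ (x, x'), (y, y')] = ([~ x, y], [~ x', y']) by [].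
  have -> : (x, x') ^ (h, h') = (x ^ h, x' ^ h') by [].
  have -> : (y, y') ^ (h, h') = (y ^ h, y' ^ h') by [].
  by rewrite xy xy' xh xh' yh yh'.
exact: card_exponent_p2_relations.
Qed.

(** * Eigenvector generators of an Isaacs group *)

Lemma extraspecial_p3_gen (p : nat) (gT : finGroupType) (P : {group gT}) (x y : gT) :
    prime p -> #|P| = (p ^ 3)%N -> x \in P -> y \in P -> [~ x, y] != 1 ->
  P :=: <<[set x; y]>>.
Proof.
move=> p_pr oP Px Py nxy; pose Q := <<[set x; y]>>%G.
have sQP : Q \subset P by rewrite gen_subG; apply/subsetP=> t /set2P[]->.
have pP : p.-group P by rewrite /pgroup oP pnatX pnat_id.
apply/eqP; rewrite eq_sym eqEcard sQP oP /= leqNgt.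
apply: contra nxy => oQ; apply/commgP.
(* A proper subgroup of [P] has order at most p^2. *)
have abQ : abelian Q.
  apply: (p2group_abelian (pgroupS sQP pP)).
  by rewrite -ltnS -(ltn_exp2l _ _ (prime_gt1 p_pr)) -(card_pgroup (pgroupS sQP pP)).
by apply: (centsP abQ); rewrite mem_gen // !inE eqxx ?orbT.
Qed.

Lemma normal_Sylow_Hall_ex (p : nat) (gT : finGroupType) (G P : {group gT}) :
  p.-Sylow(G) P -> P <| G -> exists H : {group gT}, p^'.-Hall(G) H.
Proof.
move=> sylP nPG.
have /splitsP[H cH] := SchurZassenhaus_split (pHall_Hall sylP) nPG.
by exists H; rewrite -(compl_pHall H sylP).
Qed.

(** Since [P] is nonabelian, two of its generating eigenvectors fail to commute; they generate [P],
    and h generates a complement. *)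
Lemma isaacs_eigen_generators (p r : nat) (gT : finGroupType) (G P : {group gT}) :
    prime p -> primitive_root_mod p r -> isaacs_group p G -> p.-Sylow(G) P ->
  exists x y h a b,
    [/\ [/\ x \in P, y \in P & h ^+ p.-1 = 1],
        [~ x, y] != 1, {in 'Z(P), forall z, z ^ h = z ^+ r},
        x ^ h = x ^+ a /\ y ^ h = y ^+ b
      & G :=: <<[set x; y; h]>>].
Proof.
move=> p_pr Pr isG sylP.
have [nPG esP oP cGZ] := isaacs_structure p_pr isG sylP.
have pP := pHall_pgroup sylP; have sPG := pHall_sub sylP.
have [H hallH] := normal_Sylow_Hall_ex sylP nPG.
have /complP[_ PH] : H \in [complements to P in G] by rewrite (compl_pHall H sylP).
have [h [HE oh Zh]] := isaacs_complement p_pr Pr isG sylP hallH.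
have Gh : h \in G by rewrite -cycle_subG -HE (pHall_sub hallH).
have nPh : h \in 'N(P) by rewrite (subsetP (normal_norm nPG)).
have h1 : h ^+ p.-1 = 1 by rewrite -oh expg_order.
have := extraspecial_gen_eigen pP esP nPh h1; set S := [set x in P | _] => sPS.
have SP : P :=: <<S>>.
  apply/eqP; rewrite eqEsubset gen_subG; apply/andP; split=> //.
  by apply/subsetP=> x; rewrite inE => /andP[].
have : ~~ abelian S by rewrite -abelian_gen -SP (extraspecial_nonabelian esP).
case/subsetPn=> x Sx; rewrite -sub_cent1 => /subsetPn[y Sy /cent1P nxy].
move: Sx Sy; rewrite !inE => /andP[Px /cycleP[a xh]] /andP[Py /cycleP[b yh]].
have nt : [~ x, y] != 1 by apply/commgP => /commute_sym.
exists x, y, h, a, b; split=> //.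
apply/eqP; rewrite eqEsubset gen_subG; apply/andP; split; last first.
  by apply/subsetP=> t /setUP[/set2P[]|/set1P] -> //; apply: (subsetP sPG).
rewrite -PH HE mul_subG // ?cycle_subG ?mem_gen ?inE ?eqxx ?orbT //.
by rewrite (extraspecial_p3_gen p_pr oP Px Py nt) genS // subsetUl.
Qed.

(** The residues of i and j sum to 1 or to 2n + 1; the smaller positive residue is at most n and
    equals k + 1. *)
Lemma exponent_pair_index (n i j : nat) :
    0 < n -> i + j = 1 %[mod n.*2] ->
  exists2 k, k < n
    & i = k.+1 %[mod n.*2] /\ j = n.*2 - k %[mod n.*2]
      \/ j = k.+1 %[mod n.*2] /\ i = n.*2 - k %[mod n.*2].
Proof.
move=> n0; rewrite -modnDm.
have m0 : 0 < n.*2 by lia.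
have /andP[] : (i %% n.*2 < n.*2) && (j %% n.*2 < n.*2) by rewrite !ltn_pmod.
move: (i %% _) (j %% _) => i0 j0 lti ltj; rewrite (@modn_small 1); last lia.
have [lt_ij | le_ij] := ltnP (i0 + j0) n.*2.
  (* The residues are 0 and 1; for k = 0 the value 2n - k is 0 mod 2n. *)
  rewrite modn_small // => ij1; exists 0 => //.
  rewrite subn0 modnn modn_small; last lia.
  by case: i0 ij1 {lti lt_ij} => [|i0] ij1; [right | left]; lia.
rewrite -(subnK le_ij) modnDr modn_small => [ij1|]; last lia.
have [le_in | lt_ni] := leqP i0 n.
  by exists i0.-1; [lia | left; rewrite !modn_small; lia].
by exists j0.-1; [lia | right; rewrite !modn_small; lia].
Qed.

Lemma expg_eq_mod (gT : finGroupType) (x : gT) (p m n : nat) :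
  x ^+ p = 1 -> m = n %[mod p] -> x ^+ m = x ^+ n.
Proof. by move=> xp eq_mn; rewrite -(expg_mod m xp) eq_mn expg_mod. Qed.

Lemma commg_expXX (gT : finGroupType) (x y : gT) (a b : nat) :
    commute x [~ x, y] -> commute y [~ x, y] ->
  [~ x ^+ a, y ^+ b] = [~ x, y] ^+ (a * b).
Proof.
move=> cx cy; rewrite commXg; last first.
  by rewrite commgX //; apply: commuteX.
by rewrite commgX // -expgM mulnC.
Qed.

Lemma extraspecial_commg_center (gT : finGroupType) (P : {group gT}) (x y : gT) :
  extraspecial P -> x \in P -> y \in P -> [~ x, y] \in 'Z(P).
Proof. by case=> [[_ <-] _] Px Py; apply: mem_commg. Qed.

Lemma center_commute (gT : finGroupType) (P : {group gT}) (x z : gT) :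
  x \in P -> z \in 'Z(P) -> commute x z.
Proof. by move=> Px /centerP[_ cz]; apply/commute_sym/cz. Qed.

(** Conjugation by h sends [[~ x, y]], which has order p, to [x^a, y^b] = [x, y]^(a b). *)
Lemma eigenvalue_prod (p r a b : nat) (gT : finGroupType) (P : {group gT})
    (x y h : gT) :
    prime p -> p.-group P -> extraspecial P -> x \in P -> y \in P ->
    [~ x, y] != 1 -> [~ x, y] ^ h = [~ x, y] ^+ r ->
    x ^ h = x ^+ a -> y ^ h = y ^+ b ->
  a * b = r %[mod p].
Proof.
move=> p_pr pP esP Px Py nt zh xh yh.
have Zz := extraspecial_commg_center esP Px Py.
have oz : #[[~ x, y]] = p.
  by apply: nt_prime_order => //; rewrite -(card_center_extraspecial pP esP) expg_cardG.
apply/eqP; rewrite -oz -eq_expg_mod_order -zh conjRg xh yh.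
by rewrite commg_expXX //; apply: center_commute Zz.
Qed.

Lemma odd_pred_double (p : nat) :
  1 < p -> odd p -> p.-1 = ((p - 1) %/ 2).*2 /\ 0 < (p - 1) %/ 2.
Proof.
by move=> p1 p_odd; have := odd_double_half p; rewrite p_odd divn2; lia.
Qed.

(** With a = r^i and b = r^j mod p, the relation a b = r becomes i + j = 1 mod p - 1. Exchanging x
    and y if needed puts (i, j) in the form (k + 1, p - 1 - k). *)
Lemma isaacs_exponent_p_generators (p r : nat) (gT : finGroupType)
    (G P : {group gT}) :
    prime p -> odd p -> primitive_root_mod p r -> isaacs_group p G ->
    p.-Sylow(G) P -> exponent P = p ->
  exists2 k, k < (p - 1) %/ 2 & exists x y h,
    [/\ exponent_p_relations p (r ^ k.+1) (r ^ (p.-1 - k)) x y h,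
        [~ x, y] != 1 & G :=: <<[set x; y; h]>>].
Proof.
move=> p_pr p_odd Pr isG sylP expP.
have [x [y [h [a [b [[Px Py h1] nt Zh [xh yh] GE]]]]]] :=
  isaacs_eigen_generators p_pr Pr isG sylP.
have [nPG esP oP _] := isaacs_structure p_pr isG sylP.
have pP := pHall_pgroup sylP.
have Zz := extraspecial_commg_center esP Px Py.
have ab_r := eigenvalue_prod p_pr pP esP Px Py nt (Zh _ Zz) xh yh.
have co_ab : coprime p (a * b).
  by rewrite -coprime_modr ab_r coprime_modr (primitive_root_coprime p_pr Pr).
move: co_ab; rewrite coprimeMr !prime_coprime //.
case/andP=> /(proj2 Pr)[i ai] /(proj2 Pr)[j bj].
have exp1 u : u \in P -> u ^+ p = 1 by move=> Pu; rewrite -expP expg_exponent.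
have ij1 : i + j = 1 %[mod p.-1].
  apply/eqP; rewrite -(primitive_root_eq_mod _ _ p_pr Pr) expnD expn1 -ab_r.
  by rewrite -modnMm -ai -bj modnMm.
pose n := ((p - 1) %/ 2)%N.
have [n2 n0] : p.-1 = n.*2 /\ 0 < n := odd_pred_double (prime_gt1 p_pr) p_odd.
have eq_pow u e c l : u \in P -> c = r ^ e %[mod p] -> e = l %[mod n.*2] ->
  u ^+ c = u ^+ (r ^ l).
- move=> Pu ce el; apply: (expg_eq_mod (exp1 u Pu)); rewrite ce; apply/eqP.
  by rewrite primitive_root_eq_mod // n2; apply/eqP.
rewrite n2 in ij1; have [k ltk ijk] := exponent_pair_index n0 ij1.
exists k => //; rewrite n2; case: ijk => -[ik jk].
  exists x, y, h; split=> //; split.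
  - by rewrite !exp1 // -n2 h1.
  - exact: center_commute Zz.
  - exact: center_commute Zz.
  - by rewrite xh (eq_pow x i a k.+1).
  by rewrite yh (eq_pow y j b (n.*2 - k)).
have Zz' : [~ y, x] \in 'Z(P) by apply: extraspecial_commg_center.
exists y, x, h; split.
- split.
  - by rewrite !exp1 // -n2 h1.
  - exact: center_commute Zz'.
  - exact: center_commute Zz'.
  - by rewrite yh (eq_pow y j b k.+1).
  by rewrite xh (eq_pow x i a (n.*2 - k)).
- by rewrite -invg_comm invg_eq1.
by rewrite GE [[set x; y]]setUC.
Qed.

(** In a^p - b^p = (a - b) S, the sum S has p terms, each congruent to b^(p - 1) mod p, so both
    factors are divisible by p. *)
Lemma eqn_modX_sqr (p a b : nat) :
  0 < p -> a = b %[mod p] -> a ^ p = b ^ p %[mod p ^ 2].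
Proof.
move=> p0; wlog le_ba : a b / b <= a => [hw|].
  by case/orP: (leq_total b a) => /hw // eq_ba /esym/eq_ba.
move=> ab; apply/eqP; rewrite eqn_mod_dvd ?leq_exp2r //.
rewrite subn_exp -mulnn dvdn_mul //; first by rewrite -eqn_mod_dvd // ab.
rewrite /dvdn -modn_summ.
rewrite (eq_bigr (fun _ => b ^ p.-1 %% p)) => [|i _]; last first.
  rewrite -modnMml -modnXm ab modnXm modnMml -expnD; congr (b ^ _ %% p).
  by have := ltn_ord i; lia.
by rewrite sum_nat_const card_ord -/(dvdn _ _) dvdn_mulr.
Qed.

Lemma extraspecial_expg_center (p : nat) (gT : finGroupType) (P : {group gT}) (x : gT) :
  p.-group P -> extraspecial P -> x \in P -> x ^+ p \in 'Z(P).
Proof.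
move=> pP esP Px; have [[PhiP _] _] := esP.
rewrite -PhiP (Phi_joing pP) mem_gen // inE; apply/orP; right.
by have := Mho_p_elt 1 Px (mem_p_elt pP Px); rewrite expn1.
Qed.

Lemma exponent_p2_relations_ex (p r a b : nat) (gT : finGroupType)
    (G P : {group gT}) (x y h : gT) :
    prime p -> odd p -> primitive_root_mod p r -> p.-group P ->
    extraspecial P -> #|P| = (p ^ 3)%N ->
    x \in P -> y \in P -> h ^+ p.-1 = 1 -> [~ x, y] != 1 ->
    {in 'Z(P), forall z, z ^ h = z ^+ r} ->
    x ^ h = x ^+ a -> y ^ h = y ^+ b -> exponent P = (p ^ 2)%N ->
    x ^+ p != 1 -> G :=: <<[set x; y; h]>> ->
  exists y', exponent_p2_relations p (r ^ p) x y' h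
    /\ G :=: <<[set x; y'; h]>>.
Proof.
move=> p_pr p_odd Pr pP esP oP Px Py h1 nt Zh xh yh expP xp GE.
have oZ := card_center_extraspecial pP esP.
have Zz := extraspecial_commg_center esP Px Py.
have ab_r := eigenvalue_prod p_pr pP esP Px Py nt (Zh _ Zz) xh yh.
have co_r := primitive_root_coprime p_pr Pr.
have Zp u : u \in 'Z(P) -> u ^+ p = 1 by move=> Zu; rewrite -oZ expg_cardG.
have eig u c : u \in P -> u ^+ p != 1 -> u ^ h = u ^+ c -> c = r %[mod p].
  move=> Pu up uh; have Zu := extraspecial_expg_center pP esP Pu.
  have ou : #[u ^+ p] = p by apply: nt_prime_order => //; apply: Zp.
  by apply/eqP; rewrite -ou -eq_expg_mod_order -Zh // conjXg uh -!expgM mulnC.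
have a_r := eig x a Px xp xh.
have b1 : b = 1 %[mod p].
  apply/eqP; have : r * b == r * 1 %[mod p].
    by rewrite muln1 -modnMml -a_r modnMml ab_r a_r.
  rewrite !eqn_mod_Fp // !natrM (inj_eq (mulfI _)) //.
  by rewrite -unitfE unitFpE.
(* Otherwise b = r mod p as well, so r = 1 mod p and p - 1 divides 1, against p odd. *)
have yp : y ^+ p = 1.
  apply/eqP; apply: contraT => yp; have := eig y b Py yp yh.
  rewrite b1 => /esym/eqP; have := proj1 Pr 1%N; rewrite expn1 => ->.
  by rewrite dvdn1 => /eqP p2; move: p_odd (prime_gt0 p_pr); case: (p) p2 => [|[|[]]].
have yhy : y ^ h = y by rewrite yh (expg_eq_mod yp b1).
have xpp : x ^+ (p ^ 2) = 1 by rewrite -expP expg_exponent.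
(* From h^(p - 1) = 1 follows x^a = x^(a^p), and a = r mod p lifts to a^p = r^p mod p^2. *)
have xhr : x ^ h = x ^+ (r ^ p).
  have xA : {in <[x]>, forall t, t ^ h = t ^+ a}.
    by move=> _ /cycleP[i ->]; rewrite conjXg xh -!expgM mulnC.
  have := conjg_expn_iter p.-1 xA (cycle_id x); rewrite h1 conjg1 => xap.
  rewrite xh {1}xap -expgM -expnSr prednK ?prime_gt0 //.
  by apply: (expg_eq_mod xpp); apply: eqn_modX_sqr; rewrite ?prime_gt0.
have oz : #[[~ x, y]] = p by apply: nt_prime_order => //; apply: Zp.
have ZE : 'Z(P) = <[[~ x, y]]>.
  by apply/eqP; rewrite eq_sym eqEcard cycle_subG Zz -orderE oz oZ /=.
(* Replacing y by y^n, where x^p = [x, y]^n, turns the commutator into x^p. *)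
have := extraspecial_expg_center pP esP Px; rewrite ZE => /cycleP[n xpn].
have xyn : [~ x, y ^+ n] = x ^+ p.
  by rewrite commgX //; apply: center_commute Zz.
exists (y ^+ n); split.
  by split; rewrite ?conjXg ?yhy // xpp h1 -expgM mulnC expgM yp expg1n.
have PE : P :=: <<[set x; y ^+ n]>>.
  by apply: (extraspecial_p3_gen p_pr oP); rewrite ?groupX // xyn.
apply/eqP; rewrite GE eqEsubset !gen_subG; apply/andP; split.
  apply/subsetP=> t /setUP[/set2P[]|/set1P] ->.
  - by rewrite mem_gen // !inE eqxx.
  - by apply: (subsetP (genS (subsetUl _ _))); rewrite -PE.
  - by rewrite mem_gen // !inE eqxx orbT.
apply/subsetP=> t /setUP[/set2P[]|/set1P] ->; rewrite ?groupX // mem_gen //;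
  by rewrite !inE eqxx ?orbT.
Qed.

(** One of x and y has order p^2. Otherwise [P] = Omega_1(P), which has exponent dividing p since p
    is odd and [P] has class at most 2. *)
Lemma isaacs_exponent_p2_generators (p r : nat) (gT : finGroupType)
    (G P : {group gT}) :
    prime p -> odd p -> primitive_root_mod p r -> isaacs_group p G ->
    p.-Sylow(G) P -> exponent P = (p ^ 2)%N ->
  exists x y h,
    exponent_p2_relations p (r ^ p) x y h /\ G :=: <<[set x; y; h]>>.
Proof.
move=> p_pr p_odd Pr isG sylP expP.
have [x [y [h [a [b [[Px Py h1] nt Zh [xh yh] GE]]]]]] :=
  isaacs_eigen_generators p_pr Pr isG sylP.
have [nPG esP oP _] := isaacs_structure p_pr isG sylP.
have pP := pHall_pgroup sylP.
have [xp|xp] := eqVneq (x ^+ p) 1; last first.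
  have [y' Ry'] := exponent_p2_relations_ex p_pr p_odd Pr pP esP oP Px Py h1
    nt Zh xh yh expP xp GE.
  by exists x, y', h.
have [yp|yp] := eqVneq (y ^+ p) 1; last first.
  have nt' : [~ y, x] != 1 by rewrite -invg_comm invg_eq1.
  have GE' : G :=: <<[set y; x; h]>> by rewrite GE [[set x; y]]setUC.
  have [x' Rx'] := exponent_p2_relations_ex p_pr p_odd Pr pP esP oP Py Px h1
    nt' Zh yh xh expP yp GE'.
  by exists y, x', h.
have cl2 : nil_class P <= 2 by have [[_ P1] _] := esP; rewrite nil_class2 P1.
have sP1 : P \subset 'Ohm_1(P).
  have : <<[set x; y]>> \subset 'Ohm_1(P); last first.
    by rewrite -(extraspecial_p3_gen p_pr oP Px Py nt).
  rewrite gen_subG.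
  rewrite /= (OhmE 1 pP); apply/subsetP=> t /set2P[] ->; rewrite mem_gen // !inE expn1.
    by rewrite Px xp eqxx.
  by rewrite Py yp eqxx.
have := dvdn_trans (exponentS sP1) (exponent_Ohm1_class2 p_odd pP cl2).
rewrite expP => /(dvdn_leq (prime_gt0 p_pr)).
by rewrite leqNgt -{1}[p]expn1 ltn_exp2l ?prime_gt1.
Qed.

(** * Invariance of the index k *)

Lemma exponent_pair_index_inj (n k k' : nat) :
  k < n -> k' < n -> k'.+1 + (n.*2 - k) = 1 %[mod n.*2] -> k = k'.
Proof.
(* The sum lies between n + 2 and 3n, where only 2n + 1 is 1 mod 2n. *)
move=> ltk ltk'; rewrite (@modn_small 1); last lia.
have [lt_e | le_e] := ltnP (k'.+1 + (n.*2 - k)) n.*2.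
  by rewrite modn_small //; lia.
by rewrite -(subnK le_e) modnDr modn_small; lia.
Qed.

(** The sum lies between 2 and 2n, so it is not 1 mod 2n. *)
Lemma exponent_pair_index_neq (n k k' : nat) :
  k < n -> k' < n -> k'.+1 + k.+1 <> 1 %[mod n.*2].
Proof.
move=> ltk ltk'; rewrite (@modn_small 1); last lia.
have [lt_e | le_e] := ltnP (k'.+1 + k.+1) n.*2.
  by rewrite modn_small //; lia.
by rewrite -(subnK le_e) modnDr modn_small; lia.
Qed.

(* The eigenvalues of h are r ^ i and r ^ j with i + j = 1 mod p - 1; the
   unordered pair {i, j} is encoded by k < (p - 1) / 2. *)
Definition has_exponent_p_type (p r k : nat) (gT : finGroupType) (G : {group gT}) :=
  exists x y h,
    [/\ [/\ x \in G, y \in G & h \in G],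
        exponent_p_relations p (r ^ k.+1) (r ^ (p.-1 - k)) x y h
      & [~ x, y] != 1].

Lemma isog_exponent_p_type (p r k : nat) (gT rT : finGroupType)
    (G : {group gT}) (H : {group rT}) :
  G \isog H -> has_exponent_p_type p r k G -> has_exponent_p_type p r k H.
Proof.
case/isogP=> f injf HE [x [y [h [[Gx Gy Gh] [[xp yp hp] cx cy xh yh] nt]]]].
have Gz : [~ x, y] \in G by apply: groupR.
exists (f x), (f y), (f h); split; first by rewrite -HE !mem_morphim.
  rewrite /exponent_p_relations -!morphX // xp yp hp -morphR // -!morphJ //.
  rewrite xh yh morph1; split=> //.
    by rewrite /commute -!morphM // cx.
  by rewrite /commute -!morphM // cy.
by rewrite -morphR // morph_injm_eq1.
Qed.

Lemma commg_mulr_center (gT : finGroupType) (P : {group gT}) (x y z : gT) :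
  x \in P -> y \in P -> z \in 'Z(P) -> [~ x, y * z] = [~ x, y].
Proof.
move=> Px Py Zz; rewrite !commgEl conjgM; congr (_ * _).
by apply/conjg_fixP/commgP/(center_commute _ Zz); rewrite groupJ.
Qed.

(** Both h and h' act on Z(P) as the r-th power, so they agree modulo C_G(Z(P)) = [P] and act alike
    on P / Z(P). An eigenvector of h' is then paired with one of h that does not commute with it. *)
Lemma exponent_p_type_uniq (p r k k' : nat) (gT : finGroupType) (G : {group gT}) :
    prime p -> odd p -> primitive_root_mod p r -> isaacs_group p G ->
    k < (p - 1) %/ 2 -> k' < (p - 1) %/ 2 ->
    has_exponent_p_type p r k G -> has_exponent_p_type p r k' G ->
  k = k'.
Proof.
move=> p_pr p_odd Pr isG ltk ltk'.
have [P sylP] := Sylow_exists p G.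
have [nPG esP oP cGZ] := isaacs_structure p_pr isG sylP.
have pP := pHall_pgroup sylP.
have [p2 _] := odd_pred_double (prime_gt1 p_pr) p_odd.
have inP u : u \in G -> u ^+ p = 1 -> u \in P.
  move=> Gu up; rewrite (mem_normal_Hall sylP) // /p_elt.
  by apply: pnat_dvd (pnat_id p_pr); rewrite order_dvdn up.
have oZ := card_center_extraspecial pP esP.
(* The two eigenvalues multiply to r^p, which is r mod p. *)
have actZ l x y h : l < (p - 1) %/ 2 -> x \in P -> y \in P -> [~ x, y] != 1 ->
    exponent_p_relations p (r ^ l.+1) (r ^ (p.-1 - l)) x y h ->
  {in 'Z(P), forall z, z ^ h = z ^+ r}.
- move=> ltl Px Py nt [[xp yp hp] cx cy xh yh].
  have Zz := extraspecial_commg_center esP Px Py.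
  have zp : [~ x, y] ^+ p = 1 by rewrite -oZ expg_cardG.
  have oz : #[[~ x, y]] = p by apply: nt_prime_order.
  have -> : 'Z(P) = <[[~ x, y]]>.
    by apply/eqP; rewrite eq_sym eqEcard cycle_subG Zz -orderE oz oZ /=.
  move=> _ /cycleP[i ->].
  rewrite conjXg conjRg xh yh commg_expXX // -expnD -!expgM.
  apply: (expg_eq_mod zp); rewrite mulnC -modnMmr.
  have -> : (l.+1 + (p.-1 - l) = p)%N by clear -p2 ltl; lia.
  by rewrite fermat_little // modnMmr.
move=> [x [y [h [[Gx Gy Gh] Rx nt]]]] [x' [y' [h' [[Gx' Gy' Gh'] Rx' nt']]]].
have [[xp yp hp] cx cy xh yh] := Rx; have [[xp' yp' hp'] cx' cy' xh' yh'] := Rx'.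
have {Gx} Px := inP x Gx xp; have {Gy} Py := inP y Gy yp.
have {Gx'} Px' := inP x' Gx' xp'; have {Gy'} Py' := inP y' Gy' yp'.
have Zh := actZ k x y h ltk Px Py nt Rx.
have Zh' := actZ k' x' y' h' ltk' Px' Py' nt' Rx'.
have nPh' : h' \in 'N(P) by rewrite (subsetP (normal_norm nPG)).
have nPh : h \in 'N(P) by rewrite (subsetP (normal_norm nPG)).
have Pg : h^-1 * h' \in P.
  rewrite -cGZ inE groupM ?groupV //=; apply/centP=> z Zz.
  apply/commute_sym/commgP/conjg_fixP.
  rewrite conjgM.
  have Zhz : z ^ h^-1 \in 'Z(P).
    by rewrite memJ_norm // groupV (subsetP (gFnorms _ _)).
  by rewrite Zh' // -Zh // conjgKV.
(* Modulo Z(P), h' also raises s to the b-th power, and central factors do not change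
   commutators. *)
have key s b : s \in P -> s ^ h = s ^+ b -> [~ x', s] != 1 ->
  r ^ k'.+1 * b = r %[mod p].
- move=> Ps sh nts.
  have Zz := extraspecial_commg_center esP Px' Ps.
  have oz : #[[~ x', s]] = p by apply: nt_prime_order => //; rewrite -oZ expg_cardG.
  apply/eqP; rewrite -oz -eq_expg_mod_order -Zh' // conjRg xh'.
  have -> : s ^ h' = s ^+ b * [~ s ^+ b, h^-1 * h'].
    by rewrite -conjg_mulR -sh -conjgM mulKVg.
  rewrite (commg_mulr_center (P := P)) ?groupX //; last first.
    by apply: extraspecial_commg_center; rewrite ?groupX.
  by rewrite commg_expXX //; apply: center_commute Zz.
have eqmod e : r ^ e = r %[mod p] -> e = 1 %[mod p.-1].
  move=> er; apply/eqP; rewrite -(primitive_root_eq_mod _ _ p_pr Pr) expn1.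
  exact/eqP.
(* As x' is not central, it fails to commute with x or y. The case of y gives k = k'; that of x
   gives k + k' + 2 = 1 mod p - 1, which is impossible. *)
have [cxx | nxx] := eqVneq [~ x', x] 1.
  have [cxy | nxy] := eqVneq [~ x', y] 1.
    case/eqP: nt'; apply/eqP/commgP.
    have : x' \in 'Z(P).
      rewrite inE Px' /= (extraspecial_p3_gen p_pr oP Px Py nt) cent_gen.
      by apply/centP=> t /set2P[] ->; apply/commgP/eqP.
    by move=> Zx'; apply/commute_sym/(center_commute _ Zx').
  have := key y _ Py yh nxy; rewrite -expnD => /eqmod.
  by rewrite p2; apply: exponent_pair_index_inj.
have := key x _ Px xh nxx; rewrite -expnD => /eqmod.
by rewrite p2 => /(exponent_pair_index_neq ltk ltk').
Qed.

(** * Construction of the groups *)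

(** On Z(N) the character is chi(1) times a linear character, so for g in the inertia group z^g z^-1
    lies in the trivial kernel. Hence g centralises Z(N) and lies in [N], and induction from the
    inertia group [N] is irreducible. *)
Lemma Ind_irr_faithful (gT : finGroupType) (G N : {group gT}) (i : Iirr N) :
    N <| G -> cfaithful ('chi_i)%R -> 'C_G('Z(N)) \subset N ->
  ('Ind[G] 'chi_i)%R \in irr G.
Proof.
move=> nsNG fful cGZ; have ZE := cfcenter_fful_irr fful.
have /group_inj defN : 'I_G[('chi_i)%R]%CF = N.
  apply/eqP; rewrite eqEsubset (sub_Inertia _ (normal_sub nsNG)) andbT.
  apply: subset_trans cGZ; apply/subsetP=> g /setIP[Gg Ig]; rewrite inE Gg /=.
  apply/centP=> z Zz; apply/commute_sym/commgP/conjg_fixP.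
  have [lam lin_lam Res_lam] := cfcenter_Res ('chi_i)%R.
  rewrite ZE in lam lin_lam Res_lam.
  have Zzg : z ^ g \in 'Z(N).
    rewrite memJ_norm //; apply: (subsetP (gFnorms _ _)).
    by apply: (subsetP (normal_norm nsNG)).
  have chiZ t : t \in 'Z(N) -> ('chi_i t = 'chi_i 1%g * lam t)%R.
    by move=> Zt; rewrite -(cfResE ('chi_i)%R (center_sub N) Zt) Res_lam cfunE.
  have lam_zg : lam (z ^ g) = lam z.
    apply: (mulfI (irr1_neq0 i)); rewrite -!chiZ //.
    exact: inertia_valJ.
  apply/eqP; rewrite eq_mulgV1 -in_set1.
  have -> : [set 1] = cfker ('chi_i)%R :> {set gT} by apply/esym/trivgP.
  have Zzi : z^-1 \in 'Z(N) by rewrite groupV.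
  rewrite cfkerEirr inE chiZ ?(groupM Zzg Zzi) //; apply/eqP.
  rewrite (lin_charM lin_lam Zzg Zzi) lam_zg -(lin_charM lin_lam Zz Zzi).
  by rewrite mulgV (lin_char1 lin_lam) mulr1.
have [] := constt_Inertia_bijection i nsNG; rewrite defN cfInd_id => -> //.
by rewrite constt_irr !inE.
Qed.

(** A p-group with cyclic centre has a faithful irreducible character, which is then induced to [G].
    This serves both constructions. *)
Lemma isaacs_of_cyclic_center (e p : nat) (gT : finGroupType) (G N : {group gT}) :
    1 < e -> #|G| = (e ^ 4 - e ^ 3)%N -> N <| G -> p.-group N ->
    cyclic 'Z(N) -> 'C_G('Z(N)) \subset N ->
    (forall i : Iirr N, cfaithful ('chi_i)%R ->
       (#|G : N|%:R * 'chi_i 1%g = (e ^ 2 - e)%:R)%R) ->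
  isaacs_group e G.
Proof.
move=> e1 oG nsNG pN cycZ cGZ deg; split=> //.
have [i fful] := pgroup_cyclic_faithful pN cycZ.
have /irrP[j chij] := Ind_irr_faithful nsNG fful cGZ.
by exists j; rewrite -chij cfInd1 ?normal_sub // deg.
Qed.

(** The degree divides p^3 and its square is at most p^2; a faithful linear character would make [P]
    abelian. *)
Lemma extraspecial_p3_faithful_degree (p : nat) (gT : finGroupType)
    (P : {group gT}) (i : Iirr P) :
    p.-group P -> extraspecial P -> #|P| = (p ^ 3)%N -> cfaithful ('chi_i)%R ->
  ('chi_i 1%g = p%:R)%R.
Proof.
move=> pP esP oP fful; have p_pr := extraspecial_prime pP esP.
have := irr1_sqr_le i (subxx 'Z(P)).
have iPZ : #|P : 'Z(P)| = (p ^ 2)%N.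
  rewrite -divgS ?center_sub // oP (card_center_extraspecial pP esP).
  by rewrite expnS mulKn // prime_gt0.
have := dvd_irr1_cardG i.
have /natrP [n chi1] := Cnat_irr1 i; rewrite chi1 iPZ -natrX ler_nat.
rewrite dvdC_nat oP => /(dvdn_pfactor _ _ p_pr)[k _ nE].
rewrite leq_sqr nE -{2}[p]expn1 leq_exp2l ?prime_gt1 // => k1.
case: k k1 nE => [|[]] // _ nE.
have lin : ('chi_i)%R \is a linear_char.
  by rewrite qualifE /= irr_char chi1 nE expn0 eqxx.
case/negP: (extraspecial_nonabelian esP); apply/derG1P/trivgP.
exact: subset_trans (lin_char_der1 lin) fful.
Qed.

(** The pair (u, t) stands for the map x -> u + t x, and the product is composition. *)
Definition affine (R : finComUnitRingType) : Type := (R * {unit R})%type.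

HB.instance Definition _ (R : finComUnitRingType) :=
  Finite.copy (affine R) (R * {unit R})%type.

Definition affine_one (R : finComUnitRingType) : affine R := (0%R, 1).
Definition affine_mul (R : finComUnitRingType) (g h : affine R) : affine R :=
  ((g.1 + FinRing.uval g.2 * h.1)%R, g.2 * h.2).
Definition affine_inv (R : finComUnitRingType) (g : affine R) : affine R :=
  ((- ((FinRing.uval g.2)^-1 * g.1))%R, g.2^-1).

Lemma affine_mulA (R : finComUnitRingType) : associative (@affine_mul R).
Proof.
move=> g h l; rewrite /affine_mul /= mulgA; congr (_, _).
by rewrite mulrDr addrA mulrA.
Qed.

Lemma affine_mul1 (R : finComUnitRingType) :
  left_id (affine_one R) (@affine_mul R).
Proof. by case=> u t; rewrite /affine_mul /= mul1g mul1r add0r. Qed.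

Lemma affine_mulV (R : finComUnitRingType) :
  left_inverse (affine_one R) (@affine_inv R) (@affine_mul R).
Proof. by move=> g; rewrite /affine_mul /= mulVg addNr. Qed.

HB.instance Definition _ (R : finComUnitRingType) :=
  Finite_isGroup.Build (affine R)
    (@affine_mulA R) (@affine_mul1 R) (@affine_mulV R).

(* The unit t acts on the Heisenberg group of R, with product
   (u, v, w) (u', v', w') = (u + u', v + v', w + w' + u v'), through
   (t ^ k u, t ^ l v, t ^ (k + l) w). *)
Definition heis (R : finComUnitRingType) (k l : nat) : Type :=
  (R * R * R * {unit R})%type.

HB.instance Definition _ (R : finComUnitRingType) (k l : nat) :=
  Finite.copy (heis R k l) (R * R * R * {unit R})%type.

Definition heis_one (R : finComUnitRingType) (k l : nat) : heis R k l :=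
  (0%R, 0%R, 0%R, 1).
Definition heis_mul (R : finComUnitRingType) (k l : nat) (g h : heis R k l) :
    heis R k l :=
  let: (u, v, w, t) := g in let: (u', v', w', t') := h in
  ((u + FinRing.uval t ^+ k * u')%R, (v + FinRing.uval t ^+ l * v')%R,
   (w + FinRing.uval t ^+ (k + l) * w' + u * (FinRing.uval t ^+ l * v'))%R, t * t').
Definition heis_inv (R : finComUnitRingType) (k l : nat) (g : heis R k l) :
    heis R k l :=
  let: (u, v, w, t) := g in
  ((- ((FinRing.uval t)^-1 ^+ k * u))%R, (- ((FinRing.uval t)^-1 ^+ l * v))%R,
   ((FinRing.uval t)^-1 ^+ (k + l) * (u * v - w))%R, t^-1).

Lemma heis_mulA (R : finComUnitRingType) (k l : nat) :
  associative (@heis_mul R k l).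
Proof.
case=> [[[u v] w] t] [[[u1 v1] w1] t1] [[[u2 v2] w2] t2].
rewrite /heis_mul /= mulgA !exprMn !exprD.
by congr (_, _, _, _); ring.
Qed.

Lemma heis_mul1 (R : finComUnitRingType) (k l : nat) :
  left_id (heis_one R k l) (@heis_mul R k l).
Proof.
case=> [[[u v] w] t]; rewrite /heis_mul /= mul1g !expr1n.
by congr (_, _, _, _); ring.
Qed.

Lemma heis_mulV (R : finComUnitRingType) (k l : nat) :
  left_inverse (heis_one R k l) (@heis_inv R k l) (@heis_mul R k l).
Proof.
case=> [[[u v] w] t]; rewrite /heis_mul /heis_one /= mulVg !exprD.
by congr (_, _, _, _); ring.
Qed.

HB.instance Definition _ (R : finComUnitRingType) (k l : nat) :=
  Finite_isGroup.Build (heis R k l)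
    (@heis_mulA R k l) (@heis_mul1 R k l) (@heis_mulV R k l).

(** * The affine group of Z/p^2 *)

Lemma affine_sndM (R : finComUnitRingType) :
  {in [set: affine R] &, {morph (fun g : affine R => g.2) : g h / g * h}}.
Proof. by []. Qed.
Canonical affine_snd_morphism (R : finComUnitRingType) :=
  Morphism (@affine_sndM R).

Lemma affine_translationX (R : finComUnitRingType) (n : nat) :
  (((1%R, 1) : affine R) ^+ n) = (n%:R%R, 1).
Proof.
elim: n => // n IHn; rewrite expgS IHn; congr (_, _); last exact: mul1g.
by rewrite /= mul1r -natr1 addrC.
Qed.

Lemma affine_translations_cycle (n : nat) :
  'ker (affine_snd_morphism 'Z_n) = <[((1%R, 1) : affine 'Z_n)]>.
Proof.
apply/setP=> -[u t]; rewrite !inE /=; apply/eqP/cycleP=> [-> | [i]].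
  by exists u; rewrite affine_translationX natr_Zp.
by rewrite affine_translationX => -[_ ->].
Qed.

(** Commuting with the translation by 1 gives u + t = 1 + u, that is t = 1. *)
Lemma affine_cent_translations (n : nat) :
  'C('ker (affine_snd_morphism 'Z_n)) \subset 'ker (affine_snd_morphism 'Z_n).
Proof.
rewrite [in X in X \subset _]affine_translations_cycle cent_cycle.
apply/subsetP=> -[u t] /cent1P/(congr1 fst) cut.
have {cut} : (u + FinRing.uval t * 1 = 1 + 1 * u)%R := cut.
rewrite mulr1 mul1r addrC => /addIr tE.
by rewrite !inE; apply/eqP/val_inj.
Qed.

Lemma card_affine (R : finComUnitRingType) :
  #|[set: affine R]| = (#|R| * #|[set: {unit R}]|)%N.
Proof. by rewrite !cardsT -card_prod. Qed.

(** The translations form a cyclic self-centralising subgroup of index p^2 - p, whose faithful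
    linear characters induce irreducibly. *)
Lemma affine_isaacs (p : nat) :
  prime p ->
  isaacs_group p [set: affine 'Z_(p ^ 2)]%G
  /\ sylow_exponent p (p ^ 2) [set: affine 'Z_(p ^ 2)]%G.
Proof.
move=> p_pr; have p1 := prime_gt1 p_pr; have p0 := prime_gt0 p_pr.
have n1 : 1 < p ^ 2 by rewrite -{1}(exp1n 2) ltn_exp2r.
pose f := affine_snd_morphism 'Z_(p ^ 2).
have oN : #|'ker f| = (p ^ 2)%N.
  rewrite affine_translations_cycle -orderE.
  apply/eqP; rewrite eqn_dvd order_dvdn affine_translationX pchar_Zp // eqxx /=.
  have := expg_order ((1%R, 1) : affine 'Z_(p ^ 2)).
  rewrite affine_translationX => -[/(congr1 val)].
  by rewrite /= val_Zp_nat // => o0; rewrite /dvdn; apply/eqP.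
have oU : #|[set: {unit 'Z_(p ^ 2)}]| = (p ^ 2 - p)%N.
  rewrite card_units_Zp ?expn_gt0 ?p0 // totient_pfactor // expn1.
  by rewrite -subn1 mulnBl mul1n mulnn.
have oG : #|[set: affine 'Z_(p ^ 2)]| = (p ^ 4 - p ^ 3)%N.
  rewrite card_affine oU card_ord Zp_cast // mulnBr -expnD -expnSr //.
have abN : abelian ('ker f) by rewrite affine_translations_cycle cycle_abelian.
have ZN : 'Z('ker f) = 'ker f by apply/center_idP.
have pN : p.-group ('ker f) by rewrite /pgroup oN pnatX pnat_id.
have nN : 'ker f <| [set: affine 'Z_(p ^ 2)] by apply: ker_normal.
have isG : isaacs_group p [set: affine 'Z_(p ^ 2)]%G.
  apply: (@isaacs_of_cyclic_center p p _ _ ('ker f)%G) => //=.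
  - by rewrite ZN affine_translations_cycle cycle_cyclic.
  - by rewrite ZN setTI affine_cent_translations.
  move=> i _; have /andP[_ /eqP ->] := char_abelianP _ abN i.
  rewrite mulr1 -divgS ?normal_sub // oG oN; congr (_%:R)%R.
  rewrite (_ : p ^ 4 - p ^ 3 = (p ^ 2) * (p ^ 2 - p))%N ?mulKn ?expn_gt0 ?p0 //.
  by rewrite mulnBr -expnD -expnSr.
split=> // Q sylQ; have [nQ esQ oQ _] := isaacs_structure p_pr isG sylQ.
(* A special p-group has exponent dividing p^2, and the translation by 1 has order p^2. *)
apply/eqP; rewrite eqn_dvd (exponent_special (pHall_pgroup sylQ) (proj1 esQ)) /=.
have o1 : #[((1%R, 1) : affine 'Z_(p ^ 2))] = (p ^ 2)%N.
  by rewrite orderE -affine_translations_cycle.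
rewrite -[X in X %| _]o1; apply: dvdn_exponent; rewrite (mem_normal_Hall sylQ nQ) ?inE //.
by rewrite /p_elt o1 pnatX pnat_id.
Qed.

(** * The Heisenberg group extended by units *)

Lemma heis_sndM (R : finComUnitRingType) (k l : nat) :
  {in [set: heis R k l] &, {morph (fun g : heis R k l => g.2) : g h / g * h}}.
Proof. by move=> [[[u v] w] t] [[[u1 v1] w1] t1]. Qed.
Canonical heis_snd_morphism (R : finComUnitRingType) (k l : nat) :=
  Morphism (@heis_sndM R k l).

Definition unipotent (R : finComUnitRingType) (k l : nat) (u v w : R) :
  heis R k l := (u, v, w, 1).

Lemma unipotentM (R : finComUnitRingType) (k l : nat) (u v w u' v' w' : R) :
  unipotent k l u v w * unipotent k l u' v' w' =
  unipotent k l (u + u')%R (v + v')%R (w + w' + u * v')%R.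
Proof.
apply: (etrans (_ : _ = heis_mul _ _)) => //.
by rewrite /heis_mul /= !expr1n !mul1r mul1g.
Qed.

(** The i-th further factor adds i u v to the third coordinate; these cross terms sum to
    ['C(n, 2)]. *)
Lemma unipotentX (R : finComUnitRingType) (k l n : nat) (u v w : R) :
  unipotent k l u v w ^+ n =
  unipotent k l (u *+ n)%R (v *+ n)%R (w *+ n + u * v *+ 'C(n, 2))%R.
Proof.
elim: n => [|n IHn]; first by rewrite expg0 !mulr0n addr0.
rewrite expgS IHn unipotentM !mulrS binS bin1; congr unipotent.
rewrite mulrnDr mulrnAr; ring.
Qed.

Lemma heis_kerE (R : finComUnitRingType) (k l : nat) (u v w : R) :
  unipotent k l u v w \in 'ker (heis_snd_morphism R k l).
Proof. by apply/kerP; rewrite ?inE. Qed.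

Lemma heis_kerP (R : finComUnitRingType) (k l : nat) (g : heis R k l) :
  reflect (exists u v w, g = unipotent k l u v w)
          (g \in 'ker (heis_snd_morphism R k l)).
Proof.
case: g => [[[u v] w] t]; rewrite !inE /=.
by apply: (iffP eqP) => [-> | [? [? [? [] _ _ _ ->]]]] //; exists u, v, w.
Qed.

Lemma heis_comm (R : finComUnitRingType) (k l : nat) :
  [~ unipotent k l (1%R : R) 0%R 0%R, unipotent k l 0%R 1%R 0%R] =
  unipotent k l 0%R 0%R 1%R.
Proof.
apply: (mulgI (unipotent k l (0%R : R) 1%R 0%R * unipotent k l 1%R 0%R 0%R)).
by rewrite -commgC !unipotentM; congr unipotent; ring.
Qed.

Lemma card_heis (R : finComUnitRingType) (k l : nat) :
  #|[set: heis R k l]| = (#|R| ^ 3 * #|[set: {unit R}]|)%N.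
Proof. by rewrite !cardsT !card_prod !expnS expn0 muln1 mulnA. Qed.

Lemma card_heis_ker (R : finComUnitRingType) (k l : nat) :
  #|'ker (heis_snd_morphism R k l)| = (#|R| ^ 3)%N.
Proof.
pose f (a : R * R * R) := unipotent k l a.1.1 a.1.2 a.2.
have -> : 'ker (heis_snd_morphism R k l) = f @: [set: R * R * R].
  apply/setP=> g; apply/heis_kerP/imsetP=> [[u [v [w ->]]] | [[[u v] w] _ ->]].
    by exists (u, v, w).
  by exists u, v, w.
rewrite card_imset => [|[[u v] w] [[u' v'] w'] [-> -> ->]] //.
by rewrite cardsT !card_prod !expnS expn0 muln1 mulnA.
Qed.

Lemma unipotent_center (R : finComUnitRingType) (k l : nat) (w : R) :
  unipotent k l 0%R 0%R w \in 'Z('ker (heis_snd_morphism R k l)).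
Proof.
apply/centerP; split=> [|_ /heis_kerP[u' [v' [w' ->]]]]; first exact: heis_kerE.
by rewrite /commute !unipotentM; congr unipotent; ring.
Qed.

Lemma heis_commute_center (R : finComUnitRingType) (k l : nat) (g : heis R k l) :
  commute g (unipotent k l 0%R 0%R 1%R) -> (FinRing.uval g.2 ^+ (k + l) = 1)%R.
Proof.
case: g => [[[u v] w] t] /(congr1 (fun g => g.1.2)) cut.
have {cut} : (w + FinRing.uval t ^+ (k + l) * 1 + u * (FinRing.uval t ^+ l * 0) =
        1 + 1 ^+ (k + l) * w + 0 * (1 ^+ l * v))%R := cut.
by rewrite mulr1 !mulr0 mul0r !addr0 expr1n mul1r addrC => /addIr.
Qed.

Definition heis_torus (R : finComUnitRingType) (k l : nat) (t : {unit R}) :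
  heis R k l := (0%R, 0%R, 0%R, t).

Lemma heis_torusX (R : finComUnitRingType) (k l n : nat) (t : {unit R}) :
  heis_torus k l t ^+ n = heis_torus k l (t ^+ n).
Proof.
elim: n => // n IHn; rewrite expgS IHn.
rewrite [LHS](_ : _ = heis_mul (heis_torus k l t) (heis_torus k l (t ^+ n))) //.
by rewrite /heis_mul /heis_torus !mulr0 !addr0 -expgS.
Qed.

(** Conjugation by g is x -> g^-1 x g, so the inverse of t is what yields positive powers of t. *)
Lemma unipotentJ (R : finComUnitRingType) (k l : nat) (u v w : R) (t : {unit R}) :
  unipotent k l u v w ^ heis_torus k l t^-1 =
  unipotent k l (FinRing.uval t ^+ k * u)%R (FinRing.uval t ^+ l * v)%R
    (FinRing.uval t ^+ (k + l) * w)%R.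
Proof.
apply: (mulgI (heis_torus k l t^-1)); rewrite -conjgC.
rewrite [LHS](_ : _ = heis_mul (unipotent k l u v w) (heis_torus k l t^-1)) //.
set x := unipotent k l (_ * u)%R _ _.
rewrite [RHS](_ : _ = heis_mul (heis_torus k l t^-1) x) // {}/x.
rewrite /heis_mul /heis_torus /unipotent mulg1 mul1g !mulr0 !mul0r !addr0 !add0r.
have tV n : (FinRing.uval t^-1%g ^+ n * FinRing.uval t ^+ n = 1)%R.
  by rewrite -exprMn (_ : _ * _ = 1)%R ?expr1n //; apply: (mulVr (valP t)).
by rewrite !mulrA !tV !mul1r.
Qed.

(** As k + 1 and p - 1 - k add up to p, a unit t scales the centre by t^p = t, hence faithfully. So
    the unipotent group contains the centraliser of its centre, and its faithful characters, of
    degree p, induce irreducibly. *)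
Lemma heis_isaacs (p r k : nat) (G := [set: heis 'F_p k.+1 (p.-1 - k)]%G) :
    prime p -> odd p -> primitive_root_mod p r -> k < p.-1 ->
  [/\ isaacs_group p G, sylow_exponent p p G & has_exponent_p_type p r k G].
Proof.
move=> p_pr p_odd Pr ltk; have p1 := prime_gt1 p_pr; have p0 := prime_gt0 p_pr.
have kl : (k.+1 + (p.-1 - k) = p)%N by clear -p1 ltk; lia.
set l := (p.-1 - k)%N in kl G *.
pose f := heis_snd_morphism 'F_p k.+1 l.
have oU : #|[set: {unit 'F_p}]| = (p - 1)%N.
  by rewrite card_finField_unit card_Fp // subn1.
have oP : #|'ker f| = (p ^ 3)%N by rewrite card_heis_ker card_Fp.
have oG : #|G| = (p ^ 4 - p ^ 3)%N.
  by rewrite card_heis card_Fp // oU mulnBr muln1 -expnSr.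
have iGP : #|G : 'ker f| = (p - 1)%N.
  rewrite -divgS ?subsetT // oG oP.
  rewrite (_ : p ^ 4 - p ^ 3 = p ^ 3 * (p - 1))%N ?mulKn ?expn_gt0 ?p0 //.
  by rewrite mulnBr muln1 -expnSr.
have pP : p.-group ('ker f) by rewrite /pgroup oP pnatX pnat_id.
have nP : 'ker f <| G by apply: ker_normal.
have nt : [~ unipotent k.+1 l (1%R : 'F_p) 0%R 0%R, unipotent k.+1 l 0%R 1%R 0%R] != 1.
  rewrite heis_comm; apply/eqP => /(congr1 (fun g => g.1.2)) /eqP.
  by rewrite (oner_eq0 'F_p).
have esP : extraspecial ('ker f).
  apply: (p3group_extraspecial pP); last by rewrite oP pfactorK.
  apply: contra nt => abP; apply/commgP.
  by apply: (centsP abP); apply: heis_kerE.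
have expP : exponent ('ker f) %| p.
  apply/exponentP=> _ /heis_kerP[u [v [w ->]]]; rewrite unipotentX.
  have char_p := pchar_Fp p_pr; rewrite !(mulrn_pchar char_p) add0r.
  (* This is where p odd gives exponent p. *)
  have /dvdnP[q ->] : p %| 'C(p, 2).
    by apply: prime_dvd_bin; rewrite //= ltn_neqAle p1 andbT; case: eqP p_odd => // <-.
  by rewrite mulrnA (mulrn_pchar char_p).
have isG : isaacs_group p G.
  apply: (isaacs_of_cyclic_center p1 oG nP pP).
  - by rewrite prime_cyclic //; case: esP.
  - apply/subsetP=> g /setIP[_ /centP cg].
    have := heis_commute_center (cg _ (unipotent_center _ _ _)).
    rewrite kl => tp; rewrite !inE; apply/eqP/val_inj => /=.
    by have := expf_card (FinRing.uval g.2 : 'F_p); rewrite card_Fp // tp.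
  move=> i fful; rewrite iGP (extraspecial_p3_faithful_degree pP esP oP fful).
  by rewrite -natrM mulnBl mul1n mulnn.
split=> //.
  move=> Q sylQ; have sylP : p.-Sylow(G) ('ker f).
    have [_ oQ] := isaacs_sylow_normal p_pr oG sylQ.
    by rewrite pHallE normal_sub // oP -(card_Hall sylQ) oQ /=.
  have [g _ ->] := Sylow_trans sylP sylQ; rewrite exponentJ.
  have [_ /(_ _ expP)/orP[/eqP exp1 | /eqP //]] := primeP p_pr.
  have P1 : 'ker f = 1 by apply/eqP; rewrite trivg_exponent exp1.
  by have := extraspecial_nonabelian esP; rewrite /= P1 abelian1.
have [t tE] : exists t : {unit 'F_p}, FinRing.uval t = r%:R%R.
  have Ur : (r%:R : 'F_p)%R \is a GRing.unit.
    by rewrite unitFpE // (primitive_root_coprime p_pr Pr).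
  by exists (FinRing.Unit Ur).
rewrite /has_exponent_p_type -/l.
exists (unipotent k.+1 l 1%R 0%R 0%R), (unipotent k.+1 l 0%R 1%R 0%R).
exists (heis_torus k.+1 l t^-1).
split; rewrite ?inE //; split.
- rewrite !unipotentX heis_torusX.
  have char_p := pchar_Fp p_pr; rewrite !(mulrn_pchar char_p).
  rewrite !(mulr0, mul0r, mul0rn, addr0) expgVn.
  have -> : t ^+ p.-1 = 1 by rewrite -subn1 -oU expg_cardG ?inE.
  by rewrite invg1.
- rewrite heis_comm; apply: (@center_commute _ ('ker f)%G); first exact: heis_kerE.
  exact: unipotent_center.
- rewrite heis_comm; apply: (@center_commute _ ('ker f)%G); first exact: heis_kerE.
  exact: unipotent_center.
- by rewrite unipotentJ unipotentX tE natrX !(mulr0, mul0r, mul0rn, addr0, mulr1).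
- by rewrite unipotentJ unipotentX tE natrX !(mulr0, mul0r, mul0rn, addr0, mulr1).
Qed.

(** * Classification *)

Lemma isaacs_card (p : nat) (gT : finGroupType) (G : {group gT}) :
  isaacs_group p G -> #|G| = (p ^ 3 * p.-1)%N.
Proof. by case=> _ -> _; rewrite -subn1 mulnBr muln1 -expnSr. Qed.

Lemma isaacs_exponent_p2_isog (p : nat) (gT rT : finGroupType)
    (G : {group gT}) (H : {group rT}) :
    prime p -> odd p -> isaacs_group p G -> sylow_exponent p (p ^ 2) G ->
    isaacs_group p H -> sylow_exponent p (p ^ 2) H ->
  G \isog H.
Proof.
move=> p_pr p_odd isG expG isH expH; have [r Pr] := ex_primitive_root_mod p_pr.
have [P sylP] := Sylow_exists p G; have [Q sylQ] := Sylow_exists p H.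
have [x [y [h [Rx GE]]]] :=
  isaacs_exponent_p2_generators p_pr p_odd Pr isG sylP (expG P sylP).
have [x' [y' [h' [Rx' HE]]]] :=
  isaacs_exponent_p2_generators p_pr p_odd Pr isH sylQ (expH Q sylQ).
exact: isog_exponent_p2_relations (prime_gt1 p_pr) Rx Rx' GE HE
   (isaacs_card isG) (isaacs_card isH).
Qed.

Lemma isaacs_exponent_p_type_ex (p r : nat) (gT : finGroupType) (G : {group gT}) :
    prime p -> odd p -> primitive_root_mod p r -> isaacs_group p G ->
    sylow_exponent p p G ->
  exists2 k, k < (p - 1) %/ 2 & has_exponent_p_type p r k G.
Proof.
move=> p_pr p_odd Pr isG expG; have [P sylP] := Sylow_exists p G.
have [k ltk [x [y [h [Rx nt GE]]]]] :=
  isaacs_exponent_p_generators p_pr p_odd Pr isG sylP (expG P sylP).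
exists k => //; exists x, y, h; split=> //.
by rewrite GE; split; rewrite mem_gen // !inE eqxx ?orbT.
Qed.

(** The triples in [has_exponent_p_type] are not stated to generate. A generating triple has some
    type k', and k' = k by uniqueness of the type. *)
Lemma isaacs_exponent_p_isog (p r k : nat) (gT rT : finGroupType)
    (G : {group gT}) (H : {group rT}) :
    prime p -> odd p -> primitive_root_mod p r -> k < (p - 1) %/ 2 ->
    isaacs_group p G -> sylow_exponent p p G -> has_exponent_p_type p r k G ->
    isaacs_group p H -> sylow_exponent p p H -> has_exponent_p_type p r k H ->
  G \isog H.
Proof.
move=> p_pr p_odd Pr ltk isG expG tG isH expH tH.
suff ex_gen (aT : finGroupType) (K : {group aT}) : isaacs_group p K ->
    sylow_exponent p p K -> has_exponent_p_type p r k K ->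
  exists x y h, exponent_p_relations p (r ^ k.+1) (r ^ (p.-1 - k)) x y h
    /\ K :=: <<[set x; y; h]>>.
- have [x [y [h [Rx GE]]]] := ex_gen _ _ isG expG tG.
  have [x' [y' [h' [Rx' HE]]]] := ex_gen _ _ isH expH tH.
  exact: isog_exponent_p_relations (prime_gt1 p_pr) Rx Rx' GE HE
   (isaacs_card isG) (isaacs_card isH).
move=> isK expK tK; have [P sylP] := Sylow_exists p K.
have [k' ltk' [x [y [h [Rx nt KE]]]]] :=
  isaacs_exponent_p_generators p_pr p_odd Pr isK sylP (expK P sylP).
suff -> : k = k' by exists x, y, h.
apply: exponent_p_type_uniq isK ltk ltk' tK _ => //; exists x, y, h; split=> //.
by rewrite KE; split; rewrite mem_gen // !inE eqxx ?orbT.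
Qed.

Unset Implicit Arguments.

Theorem theorem4 (p : nat) (p_prime : prime p) (p_odd : odd p) :
  (forall (gT : finGroupType) (G : {group gT}), isaacs_group p G ->
     [/\ p_closed p G,
         forall P : {group gT}, p.-Sylow(G) P -> P <| G ->
           extraspecial P /\ #|P| = (p ^ 3)%N,
         exists H : {group gT}, p^'.-Hall(G) H
       & forall H : {group gT}, p^'.-Hall(G) H ->
           cyclic H /\ #|H| = (p - 1)%N])
  /\ num_iso_classes
       (fun (gT : finGroupType) (G : {group gT}) =>
          isaacs_group p G /\ sylow_exponent p (p ^ 2)%N G) 1
  /\ num_iso_classes
       (fun (gT : finGroupType) (G : {group gT}) =>
          isaacs_group p G /\ sylow_exponent p p G) ((p - 1) %/ 2)%N.
Proof.
split=> [gT G isG|].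
  have [P sylP] := Sylow_exists p G.
  have [nPG esP oP cGZ] := isaacs_structure p_prime isG sylP.
  split.
  - by exists P.
  - move=> Q sylQ _; have [_ esQ oQ _] := isaacs_structure p_prime isG sylQ.
    by split.
  - exact: normal_Sylow_Hall_ex sylP nPG.
  move=> H hallH; have [r Pr] := ex_primitive_root_mod p_prime.
  have [h [HE oh _]] := isaacs_complement p_prime Pr isG sylP hallH.
  by rewrite HE cycle_cyclic -orderE oh subn1.
split.
  exists (fun _ => affine 'Z_(p ^ 2)), (fun _ => [set: affine 'Z_(p ^ 2)]%G).
  have [isA expA] := affine_isaacs p_prime.
  split=> [_ | i j _ | rT H [isH expH]]; rewrite ?(ord1 i) ?(ord1 j) //.
  by exists ord0; exact: (isaacs_exponent_p2_isog p_prime p_odd isH expH isA expA).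
have [r Pr] := ex_primitive_root_mod p_prime.
have le_n : (p - 1) %/ 2 <= p.-1 by rewrite -subn1 leq_div.
have model (i : 'I_((p - 1) %/ 2)) :=
  heis_isaacs p_prime p_odd Pr (leq_trans (ltn_ord i) le_n).
exists (fun i => heis 'F_p (val i).+1 (p.-1 - val i)).
exists (fun i => [set: heis 'F_p (val i).+1 (p.-1 - val i)]%G).
split=> [i | i j isoij | rT H [isH expH]].
- by have [] := model i.
(* The type is carried along the isomorphism, and it is unique. *)
- have [isGi _ typei] := model i; have [_ _ typej] := model j.
  have {}typej := isog_exponent_p_type (isog_symr isoij) typej.
  have lti := ltn_ord i; have ltj := ltn_ord j.
  exact/val_inj/(exponent_p_type_uniq p_prime p_odd Pr isGi lti ltj typei typej).
have [k ltk typeH] := isaacs_exponent_p_type_ex p_prime p_odd Pr isH expH.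
exists (Ordinal ltk); have [isG expG typeG] := model (Ordinal ltk).
exact: (isaacs_exponent_p_isog p_prime p_odd Pr ltk isH expH typeH).
Qed.
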